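(* Let $R$ be a standard graded algebra over a field $\Bbbk$, let $t\in\mathbb{N}\cup\{\infty\}$ and $S=R[z]/(z^t)$, where $z$ is an indeterminate of degree $1$ and $(z^\infty)$ denotes the zero ideal. Suppose that $\mathcal{H}_R$ admits an embedding and that for all $H\in\mathcal{H}_S$ there exists a $z$-stable $S$-ideal $I$ such that $H_I=H$. Then $\mathcal{H}_S$ admits an embedding.
   Context: $\mathbb{N}$ is the set of non-negative integers. A standard graded algebra over $\Bbbk$ is a graded $\Bbbk$-algebra $R=\bigoplus_{d\ge 0}R_d$ with $R_0=\Bbbk$, $R=\Bbbk[R_1]$ and $\dim_\Bbbk R_1<\infty$. For such a ring, $\mathcal{I}_R$ is the set of homogeneous ideals of $R$, partially ordered by inclusion. For $I\in\mathcal{I}_R$, $I_d$ is the degree-$d$ component, and $H_I(\mathfrak{z})=\sum_{d\in\mathbb{N}}(\dim_\Bbbk I_d)\mathfrak{z}^d\in\mathbb{Z}[[\mathfrak{z}]]$ is the Hilbert series. $\mathcal{H}_R=\{H_J : J\in\mathcal{I}_R\}$, partially ordered coefficientwise. $\mathcal{H}_R$ admits an embedding (into $\mathcal{I}_R$) if there is an order-preserving injective map $\epsilon:\mathcal{H}_R\to\mathcal{I}_R$ with $H_{\epsilon(H)}=H$ for all $H\in\mathcal{H}_R$. The same notation applies to $S$ with its total grading. Let $\mathfrak{I}=\{i\in\mathbb{Z}: 0\le i<t\}$. $S$ is multigraded (bigraded) by $S=\bigoplus_{i\in\mathbb{N}}\bigoplus_{j\in\mathfrak{I}}R_iz^j$.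 A multigraded $\Bbbk$-subspace $W\subseteq S_d$ decomposes as $W=\bigoplus_{i\in\mathfrak{I}}W_{d-i}z^i$ with $W_{d-i}\subseteq R_{d-i}$ (with $R_k=0$ for $k<0$); $W$ is called $z$-stable if $R_1W_{d-i}\subseteq W_{d-i+1}$ for all positive $i\in\mathfrak{I}$. An ideal $I\subseteq S$ is $z$-stable if $I$ is multigraded and $I_d$ is $z$-stable for all $d\ge 0$. *)

(* Defs.v *)
From HB Require Import structures.
From mathcomp Require Import all_boot all_order all_algebra.
From mathcomp Require Import boolp classical_sets functions.

Set Implicit Arguments.
Unset Strict Implicit.
Unset Printing Implicit Defensive.

Import Order.TTheory GRing.Theory Num.Theory.

Local Open Scope classical_set_scope.
Local Open Scope ring_scope.
Local Open Scope quotient_scope.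

(** Dimension *)

Definition has_dim (k : fieldType) (V : lmodType k) (W : set V) (n : nat) :=
  exists b : 'I_n -> V,
    [/\ forall i, W (b i),
        forall c : 'I_n -> k, \sum_(i < n) c i *: b i = 0 -> forall i, c i = 0
      & forall x, W x -> exists c : 'I_n -> k, x = \sum_(i < n) c i *: b i].

(* The value is 0 when W is not finite-dimensional. *)
Definition dimk (k : fieldType) (V : lmodType k) (W : set V) : nat :=
  xget 0%N [set n | has_dim W n].

(** Gradings and ideals *)

Definition is_fin_sum (V : nmodType) (gr : nat -> set V) (x : V) :=
  exists n (c : nat -> V), (forall d, gr d (c d)) /\ x = \sum_(d < n) c d.

Section Graded.
Variables (k : fieldType) (R : comAlgType k).
Implicit Type gr : nat -> set R.

Definition subspace (W : set R) :=
  W 0 /\ forall (a : k) x y, W x -> W y -> W (a *: x + y).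

Definition subalgebra (B : set R) :=
  [/\ subspace B, B 1 & forall x y, B x -> B y -> B (x * y)].

Definition graded gr :=
  [/\ forall d, subspace (gr d),
      forall x, is_fin_sum gr x,
      forall n (c : nat -> R), (forall d, gr d (c d)) ->
        \sum_(d < n) c d = 0 -> forall d, (d < n)%N -> c d = 0
    & forall i j x y, gr i x -> gr j y -> gr (i + j)%N (x * y)].

Definition standard_graded gr :=
  [/\ graded gr,
      gr 0%N = [set a%:A | a in [set: k]],
      forall B, subalgebra B -> gr 1%N `<=` B -> B = setT
    & exists n, has_dim (gr 1%N) n].

End Graded.

(* The rings below may be trivial, since R[z]/(z^0) is; MathComp's algebra
   structures are all nontrivial, hence the separate use of the ring structure
   and of the k-module structure. *)
Definition ideal (A : comPzRingType) (I : set A) :=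
  [/\ I 0, forall x y, I x -> I y -> I (x + y)
    & forall a x, I x -> I (a * x)].

Definition homogeneous_ideal (A : comPzRingType) (gr : nat -> set A) :
    set (set A) :=
  [set I | ideal I /\ forall x, I x -> is_fin_sum (fun d => I `&` gr d) x].

(** Hilbert series, as coefficient sequences, and embeddings *)

Section Hilbert.
Variables (k : fieldType) (V : lmodType k) (gr : nat -> set V).

Definition hilbert_series (I : set V) : nat -> int :=
  fun d => (dimk (I `&` gr d))%:Z.

Definition le_series (H H' : nat -> int) := forall d, H d <= H' d.

Variable ideals : set (set V).

Definition hilbert_set : set (nat -> int) := hilbert_series @` ideals.

Definition admits_embedding :=
  exists eps : (nat -> int) -> set V,
    [/\ forall H, hilbert_set H -> ideals (eps H),
        forall H, hilbert_set H -> hilbert_series (eps H) = H,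
        forall H H', hilbert_set H -> hilbert_set H' -> eps H = eps H' -> H = H'
      & forall H H', hilbert_set H -> hilbert_set H' ->
          le_series H H' -> eps H `<=` eps H'].

End Hilbert.

(** The quotient of R[z] by a principal ideal *)

Section PolyQuotient.
Variable R : comNzRingType.
Implicit Type f : {poly R}.

Definition principal f : {pred {poly R}} := fun p => `[< exists q, p = q * f >].

Lemma principalP f p : reflect (exists q, p = q * f) (p \in principal f).
Proof. exact: asboolP. Qed.

Lemma principal_zmod_closed f : zmod_closed (principal f).
Proof.
split=> [|p q /principalP[u ->] /principalP[v ->]]; apply/principalP.
  by exists 0; rewrite mul0r.
by exists (u - v); rewrite mulrBl.
Qed.

HB.instance Definition _ f :=
  GRing.isZmodClosed.Build {poly R} (principal f) (principal_zmod_closed f).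

Definition polyquot f : Type := {ideal_quot (principal f : zmodClosed {poly R})}.

HB.instance Definition _ f := GRing.Zmodule.on (polyquot f).

Variable f : {poly R}.
Local Notation Q := (polyquot f).

Definition polyquot_pi (p : {poly R}) : Q :=
  \pi_{ideal_quot (principal f : zmodClosed {poly R})} p.
Definition polyquot_repr (x : Q) : {poly R} :=
  @repr _ {ideal_quot (principal f : zmodClosed {poly R})} x.

Lemma polyquot_reprK : cancel polyquot_repr polyquot_pi.
Proof. exact: reprK. Qed.

Lemma polyquot_piP p q :
  polyquot_pi p = polyquot_pi q <-> exists u, p - q = u * f.
Proof.
split=> [/eqP|/principalP pq].
  by rewrite /polyquot_pi -Quotient.idealrBE => /principalP.
by apply/eqP; rewrite /polyquot_pi -Quotient.idealrBE.
Qed.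

Lemma polyquot_piD : {morph polyquot_pi : p q / p + q}.
Proof. exact: Quotient.pi_add. Qed.

Definition polyquot_one : Q := polyquot_pi 1.
Definition polyquot_mul (x y : Q) : Q :=
  polyquot_pi (polyquot_repr x * polyquot_repr y).

Lemma polyquot_piM p q :
  polyquot_pi (p * q) = polyquot_mul (polyquot_pi p) (polyquot_pi q).
Proof.
apply/polyquot_piP.
have /polyquot_piP[u pu] := esym (polyquot_reprK (polyquot_pi p)).
have /polyquot_piP[v qv] := esym (polyquot_reprK (polyquot_pi q)).
exists (u * q + polyquot_repr (polyquot_pi p) * v).
by rewrite mulrDl -mulrA [q * f]mulrC mulrA -pu -mulrA -qv mulrBl mulrBr subrKA.
Qed.

Lemma polyquot_ind (P : Q -> Prop) : (forall p, P (polyquot_pi p)) -> forall x, P x.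
Proof. by move=> Pp x; rewrite -(polyquot_reprK x). Qed.

Lemma polyquot_mulA : associative polyquot_mul.
Proof.
elim/polyquot_ind=> p; elim/polyquot_ind=> q; elim/polyquot_ind=> r.
by rewrite -!polyquot_piM mulrA.
Qed.

Lemma polyquot_mulC : commutative polyquot_mul.
Proof. by move=> x y; rewrite /polyquot_mul mulrC. Qed.

Lemma polyquot_mul1 : left_id polyquot_one polyquot_mul.
Proof. by elim/polyquot_ind=> p; rewrite -polyquot_piM mul1r. Qed.

Lemma polyquot_mulDl : left_distributive polyquot_mul +%R.
Proof.
elim/polyquot_ind=> p; elim/polyquot_ind=> q; elim/polyquot_ind=> r.
by rewrite -polyquot_piD -!polyquot_piM -polyquot_piD mulrDl.
Qed.

HB.instance Definition _ := GRing.Zmodule_isComPzRing.Build Q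
  polyquot_mulA polyquot_mulC polyquot_mul1 polyquot_mulDl.

End PolyQuotient.

Section PolyQuotientModule.
Variables (k : fieldType) (R : comAlgType k) (f : {poly R}).
Local Notation Q := (polyquot f).

Definition polyquot_scale (a : k) (x : Q) : Q :=
  polyquot_pi f (a%:A)%:P * x.

Lemma polyquot_scaleA a b x :
  polyquot_scale a (polyquot_scale b x) = polyquot_scale (a * b) x.
Proof.
rewrite /polyquot_scale mulrA; congr (_ * x).
by rewrite -[LHS]polyquot_piM -polyCM -scalerAl mul1r scalerA.
Qed.

Lemma polyquot_scale1 : left_id 1 polyquot_scale.
Proof. by move=> x; rewrite /polyquot_scale scale1r -[RHS]mul1r. Qed.

Lemma polyquot_scaleDr : right_distributive polyquot_scale +%R.
Proof. by move=> a x y; rewrite /polyquot_scale mulrDr. Qed.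

Lemma polyquot_scaleDl x : {morph polyquot_scale^~ x : a b / a + b}.
Proof.
by move=> a b; rewrite /polyquot_scale scalerDl polyCD polyquot_piD mulrDl.
Qed.

HB.instance Definition _ := GRing.Zmodule_isLmodule.Build k Q
  polyquot_scaleA polyquot_scale1 polyquot_scaleDr polyquot_scaleDl.

End PolyQuotientModule.

(** S = R[z]/(z^t) for t in N or t = oo; [None] encodes oo *)

Section TruncatedPoly.
Variables (k : fieldType) (R : comAlgType k) (gr : nat -> set R).
Variable t : option nat.

Definition zpow : {poly R} := if t is Some n then 'X^n else 0.

Definition trunc_poly : Type := polyquot zpow.

HB.instance Definition _ := GRing.ComPzRing.on trunc_poly.
HB.instance Definition _ := GRing.Lmodule.on trunc_poly.

Local Notation S := trunc_poly.

(* The element r z^j of S *)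
Definition monom (r : R) (j : nat) : S := polyquot_pi zpow (r%:P * 'X^j).

(* The index set {j | 0 <= j < t} *)
Definition zindex : {pred nat} := fun j => if t is Some n then (j < n)%N else true.

Definition bigr (i j : nat) : set S := [set monom r j | r in gr i].

(* R_i for i in Z, with R_i = 0 for i < 0 *)
Definition grz (i : int) : set R := if i is Posz n then gr n else [set 0].

Definition total_gr (d : nat) : set S :=
  [set x | exists r : nat -> R, (forall j, grz (d%:Z - j%:Z) (r j)) /\
             x = \sum_(j < d.+1 | (j : nat) \in zindex) monom (r j) j].

Definition multigraded (W : set S) :=
  forall x, W x -> exists n (c : nat -> nat -> S),
    (forall i j, j \in zindex -> (W `&` bigr i j) (c i j)) /\
    x = \sum_(i < n) \sum_(j < n | (j : nat) \in zindex) c i j.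

(* For W contained in S_d, the subspace W_{d-j} of R_{d-j} *)
Definition zcomponent (W : set S) (d j : nat) : set R :=
  [set r | grz (d%:Z - j%:Z) r /\ W (monom r j)].

(* The component W_{d-j+1} is the one of index j - 1. *)
Definition z_stable (d : nat) (W : set S) :=
  forall j, j \in zindex -> (0 < j)%N ->
    forall x r, gr 1%N x -> zcomponent W d j r -> zcomponent W d j.-1 (x * r).

Definition z_stable_ideal (I : set S) :=
  [/\ ideal I, multigraded I & forall d, z_stable d (I `&` total_gr d)].

End TruncatedPoly.

Arguments total_gr {k R} gr t d.

(* Main.v *)
Require Import Defs.
From mathcomp Require Import all_boot all_order all_algebra zify.
From mathcomp Require Import boolp classical_sets.

(** Why the theorem is true.

    An embedding for R is the same as a choice, in each degree [e], of a flag of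
    subspaces [L e n] of dimension [n], such that no subspace of dimension [n]
    grows more slowly than [L e n] under multiplication by R_1. The flag is read
    off the images of ideals concentrated in degrees at least [e]
    ([eps_growth_system]); write [r e n] for the growth of [L e n].

    A z-stable ideal of S = R[z]/(z^t) has in total degree [d] a profile: the
    dimensions [b e] of its components in R_e z^(d - e). Since the flags grow
    as slowly as possible, this profile is stable, [r e (b e) <= b (e + 1)].
    Among the stable profiles in degree [d] there is a distinguished chain, the
    segments, which contains exactly one profile of each possible size
    ([segment_exists], [segment_total]). The embedding for S sends [H] to the sum
    of the [L e (a e) z^(d - e)], where [a] is the segment of size [H d] in degree
    [d]. It is monotone because the segments of a given degree form a chain and
    depend only on their size.

    What has to be seen is that this sum is an ideal. For a stable subspace,
    multiplication by S_1 only adds a new top entry [r d (a d)] and, when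
    [d + 1 >= t], loses the bottom entry, because stability makes all other
    products with R_1 redundant. The result is a segment again
    ([segment_extend], [segment_truncate]). Among stable profiles of one size
    the segment has the least top entry and the largest bottom entry
    ([segment_top_le], [segment_bottom_ge]), so it grows no more than the profile
    of the z-stable ideal with series [H], hence to size at most [H (d + 1)]
    ([segment_growth]). As segments form a chain, the products lie in the segment
    chosen in degree [d + 1]. *)

Set Implicit Arguments.
Unset Strict Implicit.
Unset Printing Implicit Defensive.

Import Order.TTheory GRing.Theory Num.Theory.

(** * Stable profiles and segments *)

Section Profiles.
Variables (h : nat -> nat) (r : nat -> nat -> nat).
Hypothesis r_homo : forall e x y, x <= y -> r e x <= r e y.
Hypothesis r0 : forall e, r e 0 = 0.
Hypothesis r_le : forall e, r e (h e) <= h e.+1.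
Implicit Types (a b : nat -> nat) (lo d e f : nat).

(** A profile [a] records a subspace of degree [d] of R[z]/(z^t) that is a direct
    sum of pieces [W_e z^(d - e)]: [a e] is the dimension of [W_e]. Indexing by
    the degree [e] in R, not by the exponent of [z], makes multiplication by [z]
    the identity on profiles. Windows are half-open: total degree [d] has the
    degrees [e] with [lo <= e < d.+1], and inductions start with the empty window.
    With [h e] the dimension of degree [e] of R and [r e n] the least dimension
    reached from dimension [n] on multiplying by linear forms, stability is the
    numerical consequence of z-stability. *)
Definition stable lo d a :=
  (forall e, lo <= e -> e < d -> a e <= h e) /\
  (forall e, lo <= e -> e.+1 < d -> r e (a e) <= a e.+1).

Definition psize lo d a := \sum_(lo <= e < d) a e.

(** The numerical shadow of a lexicographic segment: [a] absorbs every stable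
    profile that starts strictly below it at some degree [f]. Quantifying over
    the competitors [b], instead of iterating the upper adjoint of [r],
    makes restriction, truncation and extension of windows immediate. *)
Definition segment lo d a :=
  stable lo d a /\
  forall f b, lo <= f -> f < d -> stable lo f.+1 b -> b f < a f ->
    forall e, lo <= e -> e <= f -> b e <= a e.

Lemma psize_recr lo d a : lo <= d -> psize lo d.+1 a = psize lo d a + a d.
Proof. exact: big_nat_recr. Qed.

Lemma psize_out lo d a : d <= lo -> psize lo d a = 0.
Proof. exact: big_geq. Qed.

Lemma eq_psize lo d a b :
  (forall e, lo <= e -> e < d -> a e = b e) -> psize lo d a = psize lo d b.
Proof. by move=> ab; apply: eq_big_nat => e /andP[? ?]; apply: ab. Qed.

Lemma psize_le lo d a b :
  (forall e, lo <= e -> e < d -> a e <= b e) -> psize lo d a <= psize lo d b.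
Proof.
move=> ab; rewrite /psize !big_seq; apply: leq_sum => e.
by rewrite mem_index_iota => /andP[? ?]; apply: ab.
Qed.

Lemma psize_le_eq lo d a b :
  (forall e, lo <= e -> e < d -> a e <= b e) -> psize lo d b <= psize lo d a ->
  forall e, lo <= e -> e < d -> b e <= a e.
Proof.
elim: d => // d IHd ab sba e loe; rewrite ltnS => led.
have lod : lo <= d by apply: leq_trans led.
have abd e' : lo <= e' -> e' < d -> a e' <= b e'.
  by move=> ? ?; apply: ab => //; apply: ltnW.
have := psize_le abd; have := ab d lod (ltnSn d).
move: sba; rewrite !psize_recr // => s1 s2 s3.
case: (ltngtP e d) led => // [ed _|-> _]; last by lia.
by apply: IHd => //; lia.
Qed.

Lemma stable_sub lo d lo' d' a :
  lo <= lo' -> d' <= d -> stable lo d a -> stable lo' d' a.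
Proof.
move=> lolo dd [ah ar]; split=> e loe ed; first by apply: ah; lia.
by apply: ar; lia.
Qed.

Lemma stable_full lo d : stable lo d h.
Proof. by split. Qed.

(** Lowering by one the entry at the least degree where [b] is nonzero keeps
    it stable, because the entry just below is then zero and [r e 0 = 0]. *)
Lemma stable_shrink lo d b n : stable lo d b -> n <= psize lo d b ->
  exists a, [/\ stable lo d a, psize lo d a = n & forall e, a e <= b e].
Proof.
move=> st_b /subnKC; move: (_ - n) => k; elim: k n => [|k IHk] n.
  by rewrite addn0 => ->; exists b.
rewrite addnS -addSn => /IHk[a [[ah ar] sa ab]].
(* The least degree of the window at which [a] does not vanish. *)
have [f [lof fd af0 fmin]] : exists f,
    [/\ lo <= f, f < d, 0 < a f & forall e, lo <= e -> e < f -> a e = 0].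
  have exf : exists f, [&& lo <= f, f < d & 0 < a f].
    apply: contrapT => nexf; suff: psize lo d a = 0 by rewrite sa.
    apply: big1_seq => e /=.
    rewrite mem_index_iota => /andP[loe ed]; apply/eqP/negPn/negP.
    by rewrite -lt0n => ae; apply: nexf; exists e; rewrite loe ed ae.
  case: (ex_minnP exf) => f /and3P[lof fd af fmin]; exists f; split=> // e loe ef.
  apply/eqP/negPn/negP; rewrite -lt0n => ae.
  have := fmin e; rewrite loe ae (ltn_trans ef fd) /= => /(_ isT).
  by rewrite leqNgt ef.
exists (fun e => if e == f then (a f).-1 else a e); split.
- split=> e loe ed.
    by case: eqP => [->|_]; [have := ah f lof fd; lia | apply: ah].
  have are := ar e loe ed.
  case: eqP => [ef|nef].
    by rewrite ifN; [subst e; apply: leq_trans are; apply: r_homo; lia | lia].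
  by case: eqP => [ef|//]; rewrite fmin ?r0 //; lia.
- have -> : n = (psize lo d a).-1 by rewrite sa.
  rewrite /psize (big_cat_nat lof (ltnW fd)) /=.
  rewrite [in RHS](big_cat_nat lof (ltnW fd)) /=.
  rewrite [X in _ + X](big_ltn fd) [in RHS](big_ltn fd) eqxx.
  rewrite (@eq_big_nat _ _ _ lo f _ a); last by move=> e ?; rewrite ifN //; lia.
  rewrite (@eq_big_nat _ _ _ f.+1 d _ a); last by move=> e ?; rewrite ifN //; lia.
  by lia.
- by move=> e; case: eqP => [->|_]; [have := ab f; lia | apply: ab].
Qed.

Lemma segment_restrict lo d d' a : d' <= d -> segment lo d a -> segment lo d' a.
Proof.
move=> dd [st_a sg_a]; split; first exact: stable_sub st_a.
by move=> f b lof fd; apply: sg_a => //; apply: leq_trans dd.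
Qed.

(** A competitor on the smaller window extends by zero to the larger one. *)
Lemma segment_truncate lo lo' d a :
  lo <= lo' -> segment lo d a -> segment lo' d a.
Proof.
move=> lolo [st_a sg_a]; split; first exact: stable_sub st_a.
move=> f b lof fd [bh br] bf e loe ef.
pose b' e := if e < lo' then 0 else b e.
have b'E e' : lo' <= e' -> b' e' = b e' by rewrite /b' ltnNge => ->.
rewrite -(b'E e loe); apply: sg_a fd _ _ _ _ ef; rewrite ?b'E //; try lia.
split=> e' loe' ed'; rewrite /b'; first by case: ltnP => // ?; apply: bh.
case: ltnP => ?; first by rewrite r0.
by rewrite ifN; [apply: br | lia].
Qed.

(** At the top degree where two segments differ, the smaller one is a competitor
    absorbed by the larger. *)
Lemma segment_total lo d a b : segment lo d a -> segment lo d b ->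
  (forall e, lo <= e -> e < d -> a e <= b e) \/
  (forall e, lo <= e -> e < d -> b e <= a e).
Proof.
elim: d => [|d IHd] sg_a sg_b; first by left.
have [lod|dlo] := leqP lo d; last by left=> e ? ?; lia.
have [abd|bad|eqd] := ltngtP (a d) (b d).
- by left=> e loe ed; apply: sg_b.2 abd _ _ _ => //; apply: sg_a.1.
- by right=> e loe ed; apply: sg_a.2 bad _ _ _ => //; apply: sg_b.1.
have [] := IHd (segment_restrict (leqnSn d) sg_a) (segment_restrict (leqnSn d) sg_b).
- move=> ab; left=> e loe; rewrite ltnS leq_eqVlt => /predU1P[->|]; last exact: ab.
  by rewrite eqd.
- move=> ba; right=> e loe; rewrite ltnS leq_eqVlt => /predU1P[->|]; last exact: ba.
  by rewrite eqd.
Qed.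

Lemma segment_le lo d a b : segment lo d a -> segment lo d b ->
  psize lo d a <= psize lo d b -> forall e, lo <= e -> e < d -> a e <= b e.
Proof.
move=> sg_a sg_b sab; have [//|ba] := segment_total sg_a sg_b.
exact: psize_le_eq ba sab.
Qed.

(** Among stable profiles of at least its size, a segment has the least top entry:
    a smaller top entry would force the whole profile below the segment. The top
    entry is the one that multiplication by R_1 makes grow. *)
Lemma segment_top_le lo d a b : lo <= d -> segment lo d.+1 a ->
  stable lo d.+1 b -> psize lo d.+1 a <= psize lo d.+1 b -> a d <= b d.
Proof.
move=> lod sg_a st_b sab; rewrite leqNgt; apply/negP => bad.
have le_ba e : lo <= e -> e < d.+1 -> b e <= a e by move=> ? ?; apply: sg_a.2 bad _ _ _.
by have := psize_le_eq le_ba sab lod (ltnSn d); rewrite leqNgt bad.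
Qed.

(** Dually, a segment has the largest bottom entry among stable profiles of at
    most its size; the bottom entry is the one killed by [z^t = 0]. Removing a top
    entry that is not smaller than that of the segment preserves the hypothesis,
    hence the induction on the top of the window. *)
Lemma segment_bottom_ge lo d a b : segment lo d a -> stable lo d b ->
  psize lo d b <= psize lo d a -> lo < d -> b lo <= a lo.
Proof.
elim: d => // d IHd sg_a st_b; have [lod|] := leqP lo d; last by lia.
have [bad _ _|abd] := ltnP (b d) (a d); first exact: sg_a.2 bad _ _ _.
rewrite !psize_recr // => sba _; move: lod; rewrite leq_eqVlt => /predU1P[lod|lod].
  by move: sba; rewrite !psize_out -?lod //; subst lo.
apply: IHd => //; [exact: segment_restrict sg_a|exact: stable_sub st_b|lia].
Qed.

(** Multiplying a z-stable subspace by all linear forms of R[z] changes only the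
    new top entry, since stability already absorbs the products with R_1 at
    the other degrees. If [b] starts below [r d (a d)], monotonicity of [r]
    puts [b d] below [a d]. *)
Lemma segment_extend lo d a : lo <= d -> segment lo d.+1 a ->
  segment lo d.+2 (fun e => if e == d.+1 then r d (a d) else a e).
Proof.
move=> lod [[ah ar] sg_a]; split; first split=> e loe ed.
- case: eqP => [->|?]; last by apply: ah; lia.
  by apply: leq_trans (r_le d); apply: r_homo; apply: ah.
- rewrite ifN; last by lia.
  by case: eqP => [[->]|?] //; apply: ar; lia.
move=> f b lof fd st_b; case: eqP => [?|nf] bf e loe ef.
  subst f; case: eqP => [->|ne]; first exact: ltnW.
  have bd : b d < a d.
    rewrite ltnNge; apply/negP => /(r_homo d).
    by rewrite leqNgt (leq_ltn_trans _ bf) // st_b.2.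
  by apply: sg_a bd _ _ _ => //; [apply: stable_sub st_b | lia].
by rewrite ifN; [apply: sg_a bf _ _ _ => //; lia | lia].
Qed.

(** Choose the least top entry [m] possible for a stable profile of size [n], and
    put under it the segment of size [n - m] given by induction. A stable profile
    with a smaller top entry has at most [n - m] below it, for otherwise size [n]
    could be reached with top entry [m - 1]; this bound, applied to its
    maximum with the segment, puts it below the segment. *)
Lemma segment_exists lo d n : n <= psize lo d h ->
  exists2 a, segment lo d a & psize lo d a = n.
Proof.
elim: d n => [|d IHd] n n_le.
  exists h; last by move: n_le; rewrite psize_out //; lia.
  by split; [apply: stable_full |].
have [lod|dlo] := leqP lo d; last first.
  exists h; last by move: n_le; rewrite psize_out //; lia.
  by split=> [|f b ? ?]; [apply: stable_full | lia].
have ex_top : exists m,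
    `[< exists a, [/\ stable lo d.+1 a, psize lo d.+1 a = n & a d = m] >].
  have [a [st_a sa _]] := stable_shrink (stable_full lo d.+1) n_le.
  by exists (a d); apply/asboolP; exists a.
case: (ex_minnP ex_top) => m /asboolP[a [st_a sa am]] m_min.
have st_ad : stable lo d a by apply: stable_sub st_a.
have s_ad : psize lo d a = n - m by rewrite -sa psize_recr // am addnK.
have mn : m <= n by rewrite -sa psize_recr // am leq_addl.
have [c sg_c sc] : exists2 c, segment lo d c & psize lo d c = n - m.
  by apply: IHd; rewrite -s_ad; apply: psize_le => e; apply: st_ad.1.
pose u e := if e == d then m else c e.
have uc e : e < d -> u e = c e by move=> ed; rewrite /u ifN //; lia.
have su : psize lo d.+1 u = n.
  rewrite psize_recr // {2}/u eqxx (eq_psize (b := c)) ?sc ?subnK // => e _.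
  exact: uc.
(* Raising the top of [b] to [m - 1] keeps it stable; if its size reached [n],
   shrinking it would contradict the minimality of [m]. *)
have small b : stable lo d.+1 b -> b d < m -> psize lo d b <= n - m.
  move=> [bh br] bm; pose b' e := if e == d then m.-1 else b e.
  have b'b e : e < d -> b' e = b e by move=> ed; rewrite /b' ifN //; lia.
  have st_b' : stable lo d.+1 b'.
    split=> e loe ed.
      rewrite /b'; case: eqP => [->|_]; last exact: bh.
      by have := st_a.1 d lod (ltnSn d); rewrite am; lia.
    rewrite b'b; last by lia.
    have := br e loe ed; rewrite /b'; case: eqP => [->|_] //; lia.
  rewrite leqNgt; apply/negP => big.
  have n_le' : n <= psize lo d.+1 b'.
    rewrite psize_recr // (eq_psize (b := b)) => [|e _]; last exact: b'b.
    by rewrite /b' eqxx; lia.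
  have [a' [st_a' sa' a'b']] := stable_shrink st_b' n_le'.
  have := m_min (a' d); have -> : `[< exists a0,
    [/\ stable lo d.+1 a0, psize lo d.+1 a0 = n & a0 d = a' d] >].
    by apply/asboolP; exists a'.
  by have := a'b' d; rewrite /b' eqxx; lia.
have st_u : stable lo d.+1 u.
  split=> e loe ed.
    rewrite /u; case: eqP => [->|ne]; first by rewrite -am; apply: st_a.1.
    by apply: sg_c.1.1 => //; lia.
  rewrite uc; last by lia.
  have [ed'|ed'] := ltnP e.+1 d; first by rewrite uc //; apply: sg_c.1.2.
  have ? : d = e.+1 by lia.
  subst d; rewrite /u eqxx -am; apply: leq_trans (st_a.2 e loe ed).
  by apply/r_homo/(segment_top_le loe sg_c st_ad); rewrite sc s_ad.
exists u => //; split=> // f b lof fd st_b.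
have [fd'|fd'] := ltnP f d.
  rewrite uc // => bf e loe ef; rewrite uc; last by lia.
  exact: sg_c.2 bf _ _ _.
have ? : f = d by lia.
subst f; rewrite {1}/u eqxx => bm e loe.
rewrite leq_eqVlt => /predU1P[->|ed]; first by rewrite /u eqxx ltnW.
rewrite uc //; have [d' dE] : exists d', d = d'.+1 by exists d.-1; lia.
subst d; rename d' into d; have lod' : lo <= d by apply: leq_trans loe ed.
have st_bd : stable lo d.+1 b by apply: stable_sub st_b.
have [bc|cb] := ltnP (b d) (c d); first exact: sg_c.2 bc _ _ _.
(* Both [b] and [c] are dominated by their maximum, which [small] bounds. *)
pose w e' := if e' < d.+1 then maxn (b e') (c e') else b e'.
have st_w : stable lo d.+2 w.
  split=> e' loe' ed'.
    rewrite /w; case: ltnP => ?; last exact: st_b.1.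
    by rewrite geq_max st_b.1 // sg_c.1.1.
  rewrite /w ifT //; have := st_b.2 e' loe' ed'.
  case: ltnP => [lt|ge] le_b.
    have := sg_c.1.2 e' loe' lt.
    by case: (leqP (b e') (c e')); lia.
  have ? : e' = d by lia.
  by subst e'; rewrite (maxn_idPl cb).
have w_small : psize lo d.+1 w <= psize lo d.+1 c.
  by rewrite sc; apply: small => //; rewrite /w ltnn.
have : w e <= c e.
  apply: psize_le_eq w_small _ loe ed => e' _ e'd.
  by rewrite /w e'd leq_maxr.
by rewrite /w ed; lia.
Qed.

(** Segments grow at most as fast as stable profiles. Here [b] and [b'] are the
    profiles of a z-stable ideal in consecutive degrees, and [a] and [a'] the
    segments of the same sizes. The window loses its lowest degree exactly when
    the relation [z^t = 0] is felt. The extension of [a] is again a segment, and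
    its size is at most that of [b'] because [a] has the least top entry and the
    largest bottom entry; so [a'] contains it. *)
Lemma segment_growth lo lo' d a a' b b' :
  lo <= d -> lo <= lo' -> lo' <= lo.+1 ->
  segment lo d.+1 a -> segment lo' d.+2 a' ->
  stable lo d.+1 b -> psize lo d.+1 b = psize lo d.+1 a ->
  psize lo' d.+2 b' = psize lo' d.+2 a' ->
  (forall e, lo' <= e -> e <= d -> b e <= b' e) -> r d (b d) <= b' d.+1 ->
  (forall e, lo' <= e -> e <= d -> a e <= a' e) /\ r d (a d) <= a' d.+1.
Proof.
move=> lod lolo lolo' sg_a sg_a' st_b sab sab' bb' rb.
pose u e := if e == d.+1 then r d (a d) else a e.
have sg_u : segment lo' d.+2 u.
  exact: segment_truncate lolo (segment_extend lod sg_a).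
have size_ext c x : psize lo' d.+2 (fun e => if e == d.+1 then x else c e) =
    psize lo' d.+1 c + x.
  rewrite psize_recr ?(leq_trans lolo') // eqxx; congr (_ + _).
  by apply: eq_psize => e _ ed; rewrite ifN //; lia.
have top : a d <= b d by apply: segment_top_le sg_a st_b _ => //; rewrite sab.
have low : psize lo' d.+1 a <= psize lo' d.+1 b.
  have [->|ne] := eqVneq lo' lo; first by rewrite sab.
  have -> : lo' = lo.+1 by lia.
  have := sab; rewrite /psize !(big_ltn (lod : lo < d.+1)).
  have := segment_bottom_ge sg_a st_b; rewrite sab => /(_ (leqnn _) lod); lia.
have su : psize lo' d.+2 u <= psize lo' d.+2 a'.
  rewrite size_ext -sab'.
  apply: (@leq_trans (psize lo' d.+1 b + r d (b d))).
    by apply: leq_add => //; apply: r_homo.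
  rewrite -size_ext; apply: psize_le => e loe ed.
  by case: eqP => [->|?] //; apply: bb' => //; lia.
have ua := segment_le sg_u sg_a' su.
split=> [e loe ed|]; last by have := ua d.+1; rewrite /u eqxx; apply; lia.
by have := ua e; rewrite /u ifN; [apply=> //; lia | lia].
Qed.

End Profiles.

(** * Dimension of subspaces *)

Local Open Scope classical_set_scope.
Local Open Scope ring_scope.

Section Dimension.
Variables (k : fieldType) (V : lmodType k).
Implicit Types (U W : set V) (m n : nat).

(** The same notion as a subspace of an algebra, for a bare k-module: R[z]/(z^t)
    may be the zero ring. *)
Definition submod W := W 0 /\ forall (a : k) x y, W x -> W y -> W (a *: x + y).

Definition indep n (b : 'I_n -> V) :=
  forall c : 'I_n -> k, \sum_(i < n) c i *: b i = 0 -> forall i, c i = 0.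

Definition spans n (w : 'I_n -> V) W :=
  forall x, W x -> exists c : 'I_n -> k, x = \sum_(i < n) c i *: w i.

Lemma submodD W x y : submod W -> W x -> W y -> W (x + y).
Proof. by move=> [_ Wl] Wx Wy; rewrite -[x]scale1r; apply: Wl. Qed.

Lemma submodZ W a x : submod W -> W x -> W (a *: x).
Proof. by move=> [W0 Wl] Wx; rewrite -[_ *: _]addr0; apply: Wl. Qed.

Lemma submod_sum W (I : Type) (s : seq I) (P : pred I) (F : I -> V) :
  submod W -> (forall i, P i -> W (F i)) -> W (\sum_(i <- s | P i) F i).
Proof.
move=> sW WF; elim/big_ind: _ => //; first exact: sW.1.
by move=> x y; apply: submodD.
Qed.

Lemma submodI U W : submod U -> submod W -> submod (U `&` W).
Proof.
move=> [U0 Ul] [W0 Wl]; split=> // a x y [Ux Wx] [Uy Wy].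
by split; [apply: Ul | apply: Wl].
Qed.

(** The coordinates of the [b i] form a matrix with free rows. *)
Lemma indep_le m n (b : 'I_m -> V) (w : 'I_n -> V) :
  indep b -> (forall i, exists c : 'I_n -> k, b i = \sum_(j < n) c j *: w j) ->
  (m <= n)%N.
Proof.
move=> ind /choice[M bM].
pose A := \matrix_(i < m, j < n) M i j.
suff : row_free A.
  by rewrite -row_leq_rank => /leq_trans -> //; apply: rank_leq_col.
rewrite -kermx_eq0; apply/eqP/row_matrixP => l; rewrite row0.
set v := row l _; have vA : v *m A = 0.
  by apply/sub_kermxP; rewrite /v row_sub.
apply/rowP => i; rewrite [RHS]mxE; apply: (ind (fun i => v 0 i)).
under eq_bigr => i0 _ do rewrite bM scaler_sumr.
rewrite exchange_big big1 // => j _.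
transitivity ((v *m A) 0 j *: w j); last by rewrite vA mxE scale0r.
rewrite mxE scaler_suml; apply: eq_bigr => i0 _.
by rewrite scalerA [A _ _]mxE.
Qed.

Lemma indep_extend n (b : 'I_n -> V) x : indep b ->
  ~ indep (fun i : 'I_n.+1 => oapp b x (unlift ord0 i)) ->
  exists c : 'I_n -> k, x = \sum_(i < n) c i *: b i.
Proof.
move=> ib /existsNP[c /not_implyP[]].
rewrite big_ord_recl unlift_none /=.
under eq_bigr do rewrite liftK /=.
move=> c0 /existsNP[i ci].
have cx : c ord0 != 0.
  apply/eqP => c00; rewrite c00 scale0r add0r in c0.
  by case: (unliftP ord0 i) ci => [j ->|->]; rewrite ?c00 // (ib _ c0).
exists (fun j => - (c ord0)^-1 * c (lift ord0 j)).
under eq_bigr do rewrite -scalerA.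
rewrite -scaler_sumr; move/eqP: c0; rewrite addr_eq0 => /eqP c0.
by rewrite scaleNr -scalerN -c0 scalerA mulVf // scale1r.
Qed.

Lemma has_dim_inj W m n : has_dim W m -> has_dim W n -> m = n.
Proof.
move=> [b [Wb ib sb]] [b' [Wb' ib' sb']]; apply/eqP; rewrite eqn_leq.
by apply/andP; split; [apply: (indep_le ib) => i; apply: sb' |
  apply: (indep_le ib') => i; apply: sb].
Qed.

Lemma dimkE W n : has_dim W n -> dimk W = n.
Proof.
move=> Wn; apply: (@has_dim_inj W) => //.
by rewrite /dimk; case: xgetP => [? -> //|/(_ n)].
Qed.

(** A longest independent family of [W], which exists since its length is at
    most [n], is a basis. *)
Lemma spans_has_dim W n (w : 'I_n -> V) :
  submod W -> spans w W -> has_dim W (dimk W).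
Proof.
move=> sW spW.
have ex0 : exists m, `[< exists2 b : 'I_m -> V, indep b & forall i, W (b i) >].
  by exists 0%N; apply/asboolP; exists (fun=> 0) => [c _|] [].
have bnd m : `[< exists2 b : 'I_m -> V, indep b & forall i, W (b i) >] -> (m <= n)%N.
  by move=> /asboolP[b ib Wb]; apply: indep_le ib _ => i; apply: spW.
case: (ex_maxnP ex0 bnd) => m /asboolP[b ib Wb] m_max.
suff Wm : has_dim W m by rewrite (dimkE Wm).
exists b; split=> // x Wx.
apply: (indep_extend ib) => ib'.
suff /m_max : `[< exists2 b : 'I_m.+1 -> V, indep b & forall i, W (b i) >].
  by rewrite ltnn.
by apply/asboolP; exists (fun i => oapp b x (unlift ord0 i)) => // i; case: unliftP => /=.
Qed.

Lemma sub_has_dim U W n : submod U -> U `<=` W -> has_dim W n ->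
  has_dim U (dimk U) /\ (dimk U <= n)%N.
Proof.
move=> sU UW [b [Wb ib sb]].
have hU : has_dim U (dimk U) by apply: (spans_has_dim sU (w := b)) => x /UW/sb.
split=> //; case: hU => b' [Ub' ib' sb'].
by apply: indep_le ib' _ => i; apply/sb/UW.
Qed.

Lemma sub_dim_eq U W n : submod U -> submod W -> U `<=` W ->
  has_dim U n -> has_dim W n -> U = W.
Proof.
move=> sU sW UW [b [Ub ib sb]] [w [Ww iw sw]]; apply/seteqP; split=> // x Wx.
suff [c ->] : exists c : 'I_n -> k, x = \sum_(i < n) c i *: b i.
  by apply: submod_sum => // j _; apply: submodZ.
apply: (indep_extend ib) => ib'; have : (n.+1 <= n)%N; last by rewrite ltnn.
by apply: indep_le ib' _ => i; apply: sw; case: unliftP => //= j _; apply: UW.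
Qed.

Lemma has_dim_set0 : has_dim [set 0 : V] 0.
Proof.
exists (fun=> 0); split=> [[]//|c _ []//|x ->].
by exists (fun=> 0); rewrite big_ord0.
Qed.

Lemma exists_sub_dim W n m : submod W -> has_dim W n -> (m <= n)%N ->
  exists U, [/\ submod U, U `<=` W & has_dim U m].
Proof.
move=> sW [b [Wb ib _]] mn.
pose w (i : 'I_m) := b (widen_ord mn i).
exists [set x | exists c : 'I_m -> k, x = \sum_(i < m) c i *: w i]; split.
- split; first by exists (fun=> 0); rewrite big1 // => i _; rewrite scale0r.
  move=> a x y [c ->] [c' ->]; exists (fun i => a * c i + c' i).
  rewrite scaler_sumr -big_split; apply: eq_bigr => i _.
  by rewrite scalerDl scalerA.
- by move=> x [c ->]; apply: submod_sum => // i _; apply: submodZ => //; apply: Wb.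
- exists w; split=> // [i|c c0 i].
    exists (fun j => (j == i)%:R); rewrite (bigD1 i) //= eqxx scale1r big1 ?addr0 //.
    by move=> j /negPf ->; rewrite scale0r.
  pose c' (j : 'I_n) := if insub (j : nat) is Some i' then c i' else 0.
  have c'w i' : c' (widen_ord mn i') = c i' by rewrite /c' /= valK.
  rewrite -c'w; apply: (ib c'); rewrite -[RHS]c0.
  rewrite (bigID (fun j : 'I_n => (j < m)%N)) /= [X in _ + X]big1 ?addr0.
    by rewrite big_ord_narrow; apply: eq_bigr => i' _; rewrite -c'w.
  by move=> j /negPf jm; rewrite /c' insubF ?scale0r.
Qed.

Lemma has_dim_add U W m n : has_dim U m -> has_dim W n ->
  (forall x y, U x -> W y -> x + y = 0 -> x = 0 /\ y = 0) ->
  submod U -> submod W ->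
  has_dim [set x + y | x in U & y in W] (m + n).
Proof.
move=> [u [Uu iu su]] [w [Ww iw sw]] dUW sU sW.
pose b (i : 'I_(m + n)) := match split i with inl i => u i | inr i => w i end.
have bE (c : 'I_(m + n) -> k) : \sum_(i < m + n) c i *: b i =
    \sum_(i < m) c (lshift n i) *: u i + \sum_(i < n) c (rshift m i) *: w i.
  rewrite big_split_ord; congr (_ + _); apply: eq_bigr => i _; rewrite /b.
    by rewrite (unsplitK (inl i)).
  by rewrite (unsplitK (inr i)).
exists b; split.
- move=> i; rewrite /b; case: (split i) => j.
    by exists (u j) => //; exists 0; [apply: sW.1 | rewrite addr0].
  by exists 0; [apply: sU.1 | exists (w j) => //; rewrite add0r].
- move=> c; rewrite bE => /dUW[||cu cw].
  + by apply: submod_sum => // i _; apply: submodZ.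
  + by apply: submod_sum => // i _; apply: submodZ.
  move=> i; rewrite -(splitK i); case: (split i) => j /=.
    exact: (iu _ cu).
  exact: (iw _ cw).
- move=> _ [x Ux [y Wy <-]]; have [c ->] := su x Ux; have [c' ->] := sw y Wy.
  exists (fun i => match split i with inl i => c i | inr i => c' i end).
  rewrite bE; congr (_ + _); apply: eq_bigr => i _.
    by rewrite (unsplitK (inl i)).
  by rewrite (unsplitK (inr i)).
Qed.

End Dimension.

Lemma has_dim_image (k : fieldType) (V V' : lmodType k) (f : V -> V')
    (W : set V) n :
  (forall a x y, f (a *: x + y) = a *: f x + f y) ->
  (forall x, f x = 0 -> x = 0) -> has_dim W n -> has_dim (f @` W) n.
Proof.
move=> fl fi [b [Wb ib sb]].
have f0 : f 0 = 0.
  have := fl 1 0 0; rewrite !scale1r addr0 => /esym/eqP.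
  by rewrite -subr_eq0 addrK => /eqP.
have fZ a x : f (a *: x) = a *: f x by rewrite -[a *: x]addr0 fl f0 addr0.
have fS (c : 'I_n -> k) : f (\sum_(i < n) c i *: b i) = \sum_(i < n) c i *: f (b i).
  rewrite (big_morph f (id1 := 0) (op1 := +%R)) // => [|x y].
    by apply: eq_bigr => i _.
  by rewrite -[x]scale1r fl !scale1r.
exists (f \o b); split=> [i|c|_ [x /sb[c ->] <-]].
- by exists (b i).
- by rewrite -fS => /fi/ib.
- by exists c.
Qed.

(** * Components of a standard graded algebra *)

Lemma spans_fintype (k : fieldType) (V : lmodType k) (T : finType)
    (w : T -> V) (W : set V) :
  (forall x, W x -> exists c : T -> k, x = \sum_t c t *: w t) ->
  exists n (w' : 'I_n -> V), spans w' W.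
Proof.
move=> spW; exists _, (w \o @enum_val T predT) => x /spW[c ->].
exists (c \o @enum_val T predT).
by rewrite (reindex (@enum_val T predT)) //; apply: onW_bij; apply: enum_val_bij.
Qed.

Lemma sum_ord_trunc (V : nmodType) (c : nat -> V) n m : (n <= m)%N ->
  (forall d, (n <= d)%N -> c d = 0) -> \sum_(d < m) c d = \sum_(d < n) c d.
Proof.
move=> /subnKC <- c0; elim: (m - n)%N => [|p IHp]; first by rewrite addn0.
by rewrite addnS big_ord_recr /= IHp c0 ?addr0 // leq_addr.
Qed.

Section Components.
Variables (k : fieldType) (R : comAlgType k) (gr : nat -> set R).

Definition is_comps (x : R) (c : nat -> R) :=
  (forall d, gr d (c d)) /\
  exists n, (forall d, (n <= d)%N -> c d = 0) /\ x = \sum_(d < n) c d.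

(** The homogeneous component of degree [e]; the default is never taken when R
    is graded. *)
Definition hcomp (e : nat) (x : R) : R := xget (fun=> 0) (is_comps x) e.

Hypothesis sg : standard_graded gr.

Lemma gr_submod d : submod (gr d).
Proof. by have [[gs _ _ _] _ _ _] := sg; apply: gs. Qed.

Lemma grM i j x y : gr i x -> gr j y -> gr (i + j)%N (x * y).
Proof. by have [[_ _ _ gM] _ _ _] := sg; apply: gM. Qed.

Lemma gr0 d : gr d 0. Proof. exact: (gr_submod d).1. Qed.

Lemma gr1 : gr 0%N 1.
Proof. by have [_ -> _ _] := sg; exists 1 => //; rewrite scale1r. Qed.

Lemma is_comps_ex x : exists c, is_comps x c.
Proof.
have [[_ /(_ x)[n [c [gc ->]]] _ _] _ _ _] := sg.
exists (fun d => if (d < n)%N then c d else 0); split.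
  by move=> d; case: ifP => // _; apply: gr0.
exists n; split=> [d|]; first by rewrite ltnNge => ->.
by apply: eq_bigr => i _; rewrite ltn_ord.
Qed.

Lemma is_comps_lin (a : k) x y c c' : is_comps x c -> is_comps y c' ->
  is_comps (a *: x + y) (fun d => a *: c d + c' d).
Proof.
move=> [gc [n [c0 ->]]] [gc' [n' [c'0 ->]]]; split.
  by move=> d; apply: (gr_submod d).2.
exists (maxn n n'); split=> [d|].
  by rewrite geq_max => /andP[? ?]; rewrite c0 // c'0 // scaler0 addr0.
rewrite -(sum_ord_trunc (leq_maxl n n') c0) -(sum_ord_trunc (leq_maxr n n') c'0).
by rewrite scaler_sumr -big_split.
Qed.

Lemma is_comps_inj x c c' : is_comps x c -> is_comps x c' -> c =1 c'.
Proof.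
move=> xc xc' e.
have := is_comps_lin (-1) xc' xc; rewrite scaleN1r addNr.
move=> [gd [n [d0 sd]]].
have [[_ _ /(_ n _ gd (esym sd)) d0' _] _ _ _] := sg.
apply/eqP; rewrite -subr_eq0 addrC -scaleN1r; apply/eqP.
by have [/d0'|/d0] := ltnP e n.
Qed.

Lemma hcompP x : is_comps x (hcomp^~ x).
Proof.
by rewrite /hcomp; case: xgetP => // none; have [c /none] := is_comps_ex x.
Qed.

Lemma hcomp_eq x c e : is_comps x c -> hcomp e x = c e.
Proof. by move=> xc; apply: (is_comps_inj (hcompP x) xc). Qed.

Lemma hcomp_lin e (a : k) x y : hcomp e (a *: x + y) = a *: hcomp e x + hcomp e y.
Proof. exact: hcomp_eq (is_comps_lin a (hcompP x) (hcompP y)). Qed.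

Lemma hcomp_id e f x : gr e x -> hcomp f x = if f == e then x else 0.
Proof.
move=> ex; apply: (hcomp_eq (c := fun d => if d == e then x else 0)).
split=> [d|]; first by case: eqP => [->|_] //; apply: gr0.
exists e.+1; split=> [d|]; first by case: ltngtP.
rewrite (bigD1 ord_max) //= eqxx big1 ?addr0 // => i.
by rewrite -val_eqE /= => /negPf ->.
Qed.

Lemma hcomp0 e : hcomp e 0 = 0.
Proof. by rewrite (hcomp_id e (gr0 0)); case: ifP. Qed.

Lemma hcompD e x y : hcomp e (x + y) = hcomp e x + hcomp e y.
Proof. by have := hcomp_lin e 1 x y; rewrite !scale1r. Qed.

Lemma hcomp_sum e (I : Type) (s : seq I) (P : pred I) (F : I -> R) :
  hcomp e (\sum_(i <- s | P i) F i) = \sum_(i <- s | P i) hcomp e (F i).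
Proof. exact: (big_morph (hcomp e) (hcompD e) (hcomp0 e)). Qed.

Lemma hcomp_mul1 a x : gr 1%N a ->
  hcomp 0 (a * x) = 0 /\ forall e, hcomp e.+1 (a * x) = a * hcomp e x.
Proof.
move=> ga; have [gc [n [c0 xE]]] := hcompP x.
suff ac : is_comps (a * x) (fun d => if d is e.+1 then a * hcomp e x else 0).
  by split=> [|e]; rewrite (hcomp_eq _ ac).
split=> [[|e]|]; [exact: gr0 | exact: (grM ga (gc e)) |].
exists n.+1; split=> [[//|e] ne|]; first by rewrite c0 ?mulr0.
by rewrite big_ord_recl add0r {1}xE mulr_sumr.
Qed.

Lemma hcomp_sumE x : exists n, forall m, (n <= m)%N -> x = \sum_(d < m) hcomp d x.
Proof.
have [_ [n [c0 xE]]] := hcompP x; exists n => m nm.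
by rewrite (sum_ord_trunc nm c0).
Qed.

(** As R is generated by R_1, stability under R_1 gives stability under R: the
    elements of R that preserve [M] form a subalgebra. *)
Lemma gr1_closed (V : lmodType k) (act : R -> V -> V) (M : set V) :
  (forall x, act 1 x = x) -> (forall a b x, act (a * b) x = act a (act b x)) ->
  (forall (c : k) a b x, act (c *: a + b) x = c *: act a x + act b x) ->
  submod M -> (forall a x, gr 1%N a -> M x -> M (act a x)) ->
  forall a x, M x -> M (act a x).
Proof.
move=> act1 actM actl sM M1 a x.
have [_ _ gen _] := sg.
suff aB : [set a | forall x, M x -> M (act a x)] a by apply: aB.
rewrite (gen [set a | forall x, M x -> M (act a x)]) //; last first.
  by move=> b gb y; apply: M1.
split=> [|y|b c bM cM y My]; first split=> [y My|c b b' bM b'M y My].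
- have -> : act 0 y = 0; last exact: sM.1.
  by rewrite -[X in act X](addNr 1) -scaleN1r actl act1 scaleN1r addNr.
- by rewrite actl; apply: sM.2; [apply: bM | apply: b'M].
- by rewrite act1.
- by rewrite actM; apply/bM/cM.
Qed.

(** Let [Q 0] be the constants and [Q e.+1] be [R_1 Q e]; each [Q e] is finitely
    spanned. The sum of the [Q e] contains 1 and is stable under R_1, so it is R,
    and [Q e] is all of degree [e]. *)
Lemma gr_has_dim d : has_dim (gr d) (dimk (gr d)).
Proof.
have [_ _ _ [n [b [gb ib sb]]]] := sg.
pose fix Q d : set R := if d is e.+1 then
  [set x | exists2 y : 'I_n -> R, forall i, Q e (y i) & x = \sum_i b i * y i]
  else gr 0%N.
have sQ e : submod (Q e).
  elim: e => [|e sQ] /=; first exact: gr_submod.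
  split=> [|a _ _ [y Qy ->] [y' Qy' ->]].
    exists (fun=> 0) => [_|]; first exact: sQ.1.
    by rewrite big1 // => i _; rewrite mulr0.
  exists (fun i => a *: y i + y' i) => [i|]; first exact: sQ.2.
  rewrite scaler_sumr -big_split; apply: eq_bigr => i _.
  by rewrite mulrDr -scalerAr.
have Qfd e : exists m (w : 'I_m -> R), spans w (Q e).
  elim: e => [|e [m [w spw]]].
    rewrite /=; have [_ -> _ _] := sg; exists 1%N, (fun=> 1) => _ [a _ <-].
    by exists (fun=> a); rewrite big_ord1.
  apply: (@spans_fintype _ _ ('I_n * 'I_m)%type (fun ij => b ij.1 * w ij.2)).
  move=> _ [y Qy ->].
  have /choice[c yE] := fun i => spw _ (Qy i).
  exists (fun ij => c ij.1 ij.2).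
  rewrite -(pair_bigA _ (fun i j => c i j *: (b i * w j))) /=.
  apply: eq_bigr => i _; rewrite yE mulr_sumr.
  by apply: eq_bigr => j _; rewrite -scalerAr.
pose B := [set x | forall e, Q e (hcomp e x)].
have sB : submod B.
  split=> [e|a x y Bx By e]; first by rewrite hcomp0; apply: (sQ e).1.
  by rewrite hcomp_lin; apply: (sQ e).2.
have BT x : B x.
  rewrite -[x]mulr1; apply: (@gr1_closed R *%R B) => //.
  - exact: mul1r.
  - by move=> *; rewrite mulrA.
  - by move=> *; rewrite mulrDl scalerAl.
  - move=> a y ga By [|e]; first by rewrite (hcomp_mul1 y ga).1; apply: (sQ 0%N).1.
    rewrite (hcomp_mul1 y ga).2; have [c ->] := sb a ga.
    exists (fun i => c i *: hcomp e y) => [i|]; first exact: submodZ.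
    by rewrite mulr_suml; apply: eq_bigr => i _; rewrite -scalerAl scalerAr.
  - move=> e; rewrite (hcomp_id e gr1); case: eqP => [->|_]; first exact: gr1.
    exact: (sQ e).1.
have [m [w spw]] := Qfd d; apply: (spans_has_dim (gr_submod d) (w := w)) => x gx.
by apply: spw; have := BT x d; rewrite (hcomp_id d gx) eqxx.
Qed.

(** A graded family of subspaces stable under R_1 spans an ideal with these
    components. *)
Lemma hcomp_ideal (W : nat -> set R) :
  (forall e, submod (W e)) -> (forall e, W e `<=` gr e) ->
  (forall e a x, gr 1%N a -> W e x -> W e.+1 (a * x)) ->
  exists I, homogeneous_ideal gr I /\ forall e, I `&` gr e = W e.
Proof.
move=> sW Wgr W1; pose I := [set x | forall e, W e (hcomp e x)].
have sI : submod I.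
  split=> [e|a x y Ix Iy e]; first by rewrite hcomp0; apply: (sW e).1.
  by rewrite hcomp_lin; apply: (sW e).2.
have IW e : I `&` gr e = W e.
  apply/seteqP; split=> x => [[Ix gx]|Wx].
    by have := Ix e; rewrite (hcomp_id e gx) eqxx.
  split; last exact: Wgr.
  move=> f; rewrite (hcomp_id f (Wgr _ _ Wx)).
  by case: eqP => [->//|_]; apply: (sW f).1.
exists I; split=> //; split.
  split; [exact: sI.1 | by move=> x y; apply: submodD |].
  apply: (@gr1_closed R *%R I) => //.
  - exact: mul1r.
  - by move=> *; rewrite mulrA.
  - by move=> *; rewrite mulrDl scalerAl.
  move=> a y ga Iy [|e]; first by rewrite (hcomp_mul1 y ga).1; apply: (sW 0%N).1.
  by rewrite (hcomp_mul1 y ga).2; apply: W1.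
move=> x Ix; have [n xE] := hcomp_sumE x.
exists n, (hcomp^~ x); split=> [d|]; last exact: xE.
by rewrite IW.
Qed.

End Components.

Lemma ideal_submod (k : fieldType) (R : comAlgType k) (I : set R) :
  ideal I -> submod I.
Proof.
move=> [I0 ID IM]; split=> // a x y Ix Iy; apply: ID => //.
by rewrite -mulr_algl; apply: IM.
Qed.

(** * The flags defined by an embedding *)

(** What the proof retains of an embedding of the Hilbert series of R: in each
    degree [e] a flag of subspaces [L e n] of dimension [n], together with their
    growth [r] under multiplication by R_1. Field [gs_growth_min] says that no
    subspace grows more slowly than the member of the flag of the same dimension,
    the analogue of a theorem of Macaulay on lexicographic segments. *)
Record growth_system (k : fieldType) (R : comAlgType k) (gr : nat -> set R)
    (L : nat -> nat -> set R) (r : nat -> nat -> nat) : Prop := GrowthSystem {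
  gs_submod : forall e n, submod (L e n);
  gs_gr : forall e n, L e n `<=` gr e;
  gs_dim : forall e n, (n <= dimk (gr e))%N -> has_dim (L e n) n;
  gs_homo : forall e n m, (n <= m)%N -> L e n `<=` L e m;
  gs_mul : forall e n m x y, (r e n <= m)%N -> gr 1%N x -> L e n y ->
    L e.+1 m (x * y);
  gs_growth_homo : forall e n m, (n <= m)%N -> (r e n <= r e m)%N;
  gs_growth0 : forall e, r e 0%N = 0%N;
  gs_growth_le : forall e, (r e (dimk (gr e)) <= dimk (gr e.+1))%N;
  gs_growth_min : forall e n m (U W : set R), submod U -> submod W ->
    U `<=` gr e -> W `<=` gr e.+1 -> has_dim U n -> has_dim W m ->
    (forall x y, gr 1%N x -> U y -> W (x * y)) -> (r e n <= m)%N
}.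

Section GrowthSystem.
Variables (k : fieldType) (R : comAlgType k) (gr : nat -> set R).
Hypothesis sg : standard_graded gr.
Variable eps : (nat -> int) -> set R.
Local Notation HS := (hilbert_set gr (homogeneous_ideal gr)).
Hypothesis eps_ideal : forall H, HS H -> homogeneous_ideal gr (eps H).
Hypothesis epsK : forall H, HS H -> hilbert_series gr (eps H) = H.
Hypothesis eps_homo : forall H H', HS H -> HS H' -> le_series H H' ->
  eps H `<=` eps H'.
Local Notation h e := (dimk (gr e)).
Local Notation gdim := (gr_has_dim sg).

(** The Hilbert series of an ideal that starts in degree [e] with dimension [n],
    has dimension [m] in degree [e.+1] and is everything above. Such ideals exist
    as soon as a subspace [U] and a subspace [W] containing [R_1 U] have these
    dimensions, and they probe the embedding in two consecutive degrees. *)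
Definition step_series (e n m d : nat) : int :=
  (if (d < e)%N then 0%N else if d == e then n
   else if d == e.+1 then m else h d)%:Z.

Lemma sub_gr_dim_le e n U : submod U -> U `<=` gr e -> has_dim U n ->
  (n <= h e)%N.
Proof.
move=> sU Ug hU; rewrite -(dimkE hU).
exact: (sub_has_dim sU Ug (gdim e)).2.
Qed.

Lemma step_series_in e n m U W : submod U -> submod W ->
  U `<=` gr e -> W `<=` gr e.+1 -> has_dim U n -> has_dim W m ->
  (forall x y, gr 1%N x -> U y -> W (x * y)) -> HS (step_series e n m).
Proof.
move=> sU sW Ug Wg hU hW U1.
pose T d : set R := if (d < e)%N then [set 0] else if d == e then U
   else if d == e.+1 then W else gr d.
have s0 : submod [set 0 : R].
  by split=> // a x y -> ->; rewrite /= scaler0 addr0.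
have [I [hI IT]] : exists I, homogeneous_ideal gr I /\ forall d, I `&` gr d = T d.
  apply: hcomp_ideal => // [d|d|d a x ga]; rewrite /T.
  - case: ifP => // _; case: eqP => // _; case: eqP => // _; exact: gr_submod.
  - case: ifP => [_ x ->|_]; first exact: gr0.
    by case: eqP => [->|_] //; case: eqP => [->|_].
  - have [de|ed|->] := ltngtP d e.
    + move=> ->; rewrite mulr0; case: ifP => // _; case: eqP => _; first exact: sU.1.
      by case: eqP => _; [exact: sW.1 | exact: gr0].
    + move=> Tx; rewrite ltnNge ltnW ?ltnS ?(ltnW ed) //= !ifN; try lia.
      apply: (grM sg ga); move: Tx; case: eqP => [->|_] //; exact: Wg.
    + by move=> Ux; rewrite ltnNge leqnSn /= ifN ?eqxx; [apply: U1 | lia].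
exists I => //; apply/funext => d; rewrite /hilbert_series IT /step_series /T.
congr Posz; case: ifP => _; first exact/dimkE/has_dim_set0.
by case: eqP => _; [exact: dimkE | case: eqP => _ //; exact: dimkE].
Qed.

Definition top_series e n := step_series e n (h e.+1).

Lemma top_series_in e n : (n <= h e)%N -> HS (top_series e n).
Proof.
move=> nh; have [U [sU Ug hU]] := exists_sub_dim (gr_submod sg e) (gdim e) nh.
apply: (step_series_in sU (gr_submod sg e.+1) Ug) => // [|x y gx Uy].
  exact: gdim.
by apply: (grM sg gx); apply: Ug.
Qed.

Lemma eps_submod H : HS H -> submod (eps H).
Proof. by move=> /eps_ideal[/ideal_submod]. Qed.

Lemma eps_dim H d n : HS H -> H d = n%:Z -> has_dim (eps H `&` gr d) n.
Proof.
move=> HH Hd; have : hilbert_series gr (eps H) d = n%:Z by rewrite epsK.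
move=> [<-]; apply: (sub_has_dim _ _ (gdim d)).1; last by move=> x [].
by apply: submodI; [exact: eps_submod | exact: gr_submod].
Qed.

(** Comparable series give nested ideals, so where the dimensions agree the
    components are equal. *)
Lemma eps_eq H H' d n : HS H -> HS H' -> le_series H H' -> H d = n%:Z ->
  H' d = n%:Z -> eps H `&` gr d = eps H' `&` gr d.
Proof.
move=> HH HH' le_H Hd H'd; apply: (@sub_dim_eq _ _ _ _ n).
- by apply: submodI; [exact: eps_submod | exact: gr_submod].
- by apply: submodI; [exact: eps_submod | exact: gr_submod].
- by apply: setSI; apply: eps_homo.
- exact: eps_dim.
- exact: eps_dim.
Qed.

(** Capping [n] makes the flag constant once it fills degree [e], so that
    monotonicity holds for all dimensions without side conditions. *)
Definition eps_comp (e n : nat) : set R :=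
  eps (top_series e (minn n (h e))) `&` gr e.

Lemma eps_comp_homo e n m : (n <= m)%N -> eps_comp e n `<=` eps_comp e m.
Proof.
move=> nm; apply: setSI; apply: eps_homo; try exact: (top_series_in (geq_minr _ _)).
move=> d; rewrite /top_series /step_series lez_nat.
by case: ifP => // _; case: ifP => // _; rewrite leq_min geq_minr geq_min nm.
Qed.

Lemma eps_comp_dim e n : (n <= h e)%N -> has_dim (eps_comp e n) n.
Proof.
move=> nh; rewrite /eps_comp (minn_idPl nh); apply: eps_dim.
  exact: top_series_in.
by rewrite /top_series /step_series ltnn eqxx.
Qed.

Lemma eps_comp_submod e n : submod (eps_comp e n).
Proof.
apply: submodI; last exact: gr_submod.
by apply/eps_submod/top_series_in/geq_minr.
Qed.

Lemma eps_comp_full e n : (h e <= n)%N -> eps_comp e n = gr e.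
Proof.
move=> hn; apply: (@sub_dim_eq _ _ _ _ (h e)); last exact: gdim.
- exact: eps_comp_submod.
- exact: gr_submod.
- by move=> x [].
- rewrite /eps_comp (minn_idPr hn); apply: eps_dim; first exact: top_series_in.
  by rewrite /top_series /step_series ltnn eqxx.
Qed.

(** The series [K] of the ideal made of [U], [W] and all higher degrees is
    comparable to [top_series e n] and to [top_series e.+1 m], and agrees with
    them in degrees [e] and [e.+1] respectively. So both flag members are
    components of the one ideal [eps K]. *)
Lemma eps_comp_mul e n m U W : submod U -> submod W ->
  U `<=` gr e -> W `<=` gr e.+1 -> has_dim U n -> has_dim W m ->
  (forall x y, gr 1%N x -> U y -> W (x * y)) ->
  forall x y, gr 1%N x -> eps_comp e n y -> eps_comp e.+1 m (x * y).
Proof.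
move=> sU sW Ug Wg hU hW U1 x y gx.
have nh := sub_gr_dim_le sU Ug hU; have mh := sub_gr_dim_le sW Wg hW.
have HK := step_series_in sU sW Ug Wg hU hW U1.
have He := top_series_in nh; have He1 := top_series_in mh.
rewrite /eps_comp (minn_idPl nh) (minn_idPl mh).
rewrite -(eps_eq (d := e) (n := n) HK He); first last.
- by rewrite /top_series /step_series ltnn eqxx.
- by rewrite /step_series ltnn eqxx.
- move=> d; rewrite /top_series /step_series lez_nat.
  by case: ifP => // _; case: ifP => // _; case: eqP.
rewrite (eps_eq (d := e.+1) (n := m) He1 HK); first last.
- by rewrite /step_series ltnNge leqnSn /= ifN ?eqxx //; lia.
- by rewrite /top_series /step_series ltnn eqxx.
- move=> d; rewrite /top_series /step_series lez_nat.
  case: ltngtP => [//|ed|->]; last by rewrite !ifN //; lia.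
  rewrite [X in (_ <= X)%N]ifN; last by lia.
  rewrite [X in (_ <= X)%N]ifN; last by lia.
  by case: eqP => [->|].
move=> [Ky gy]; split; last exact: (grM sg gx gy).
have [[_ _ IM] _] := eps_ideal HK; exact: IM.
Qed.

Lemma growth_ex e n : exists m,
  `[< forall x y, gr 1%N x -> eps_comp e n y -> eps_comp e.+1 m (x * y) >].
Proof.
exists (h e.+1); apply/asboolP => x y gx [_ gy]; rewrite eps_comp_full //.
exact: (grM sg gx gy).
Qed.

Definition growth e n := ex_minn (growth_ex e n).

Lemma growthP e n x y : gr 1%N x -> eps_comp e n y ->
  eps_comp e.+1 (growth e n) (x * y).
Proof. by rewrite /growth; case: ex_minnP => m /asboolP + _; apply. Qed.

Lemma growth_min e n m :
  (forall x y, gr 1%N x -> eps_comp e n y -> eps_comp e.+1 m (x * y)) ->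
  (growth e n <= m)%N.
Proof. by rewrite /growth; case: ex_minnP => p _ + nm; apply; apply/asboolP. Qed.

Lemma eps_growth_system : growth_system gr eps_comp growth.
Proof.
split.
- exact: eps_comp_submod.
- by move=> e n x [].
- exact: eps_comp_dim.
- exact: eps_comp_homo.
- by move=> e n m x y rm gx Ly; apply: (eps_comp_homo rm); apply: growthP.
- move=> e n m nm; apply: growth_min => x y gx Ly.
  by apply: growthP => //; apply: eps_comp_homo Ly.
- move=> e; apply/eqP; rewrite -leqn0; apply: growth_min => x y _ Ly.
  have [b [_ _ /(_ y Ly)[c ->]]] := eps_comp_dim (leq0n (h e)).
  by rewrite big_ord0 mulr0; apply: (eps_comp_submod _ _).1.
- move=> e; apply: growth_min => x y gx [_ gy].
  by rewrite eps_comp_full //; apply: (grM sg gx gy).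
- move=> e n m U W sU sW Ug Wg hU hW U1; apply: growth_min.
  exact: eps_comp_mul sU sW Ug Wg hU hW U1.
Qed.

End GrowthSystem.

(** * Coefficients in R[z]/(z^t) *)

Lemma sum_ord_delta (V : nmodType) m (P : pred nat) (F : nat -> V) (j : nat) :
  \sum_(i < m | P i) (if j == i then F i else 0) =
  if (j < m)%N && P j then F j else 0.
Proof.
rewrite -big_mkcondr /=.
have [jm|mj] := ltnP j m; last first.
  rewrite big_pred0 // => i.
  by rewrite gtn_eqF ?andbF //; apply: leq_trans (ltn_ord i) mj.
rewrite (eq_bigl (fun i => P j && (i == Ordinal jm))) => [|i]; last first.
  rewrite -val_eqE /= [_ == j]eq_sym.
  by case: eqP => [<-|_]; rewrite ?andbT // !andbF.
by case: (P j); rewrite ?big_pred1_eq ?big_pred0_eq.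
Qed.

Section Coefficients.
Variables (k : fieldType) (R : comAlgType k) (t : option nat).
Local Notation S := (trunc_poly R t).
Local Notation pi := (polyquot_pi (zpow R t)).
Implicit Types (x y : S) (j : nat) (W : nat -> set R).

(** The coefficient of [z^j]; it does not depend on the representative exactly
    when [j < t]. *)
Definition scoef j x : R := (polyquot_repr x)`_j.

Lemma scoef_pi j (p : {poly R}) : j \in zindex t -> scoef j (pi p : S) = p`_j.
Proof.
move=> jt; have /polyquot_piP[u pu] := polyquot_reprK (pi p).
apply/eqP; rewrite -subr_eq0 /scoef -coefB; apply/eqP; rewrite pu.
move: jt; rewrite /zpow /zindex unfold_in; case: t => [n jn|_].
  by rewrite coefMXn jn.
by rewrite mulr0 coef0.
Qed.

Lemma scoef_lin j (a : k) x y : j \in zindex t ->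
  scoef j (a *: x + y) = a *: scoef j x + scoef j y.
Proof.
move=> jt; elim/polyquot_ind: x => p; elim/polyquot_ind: y => q.
have -> : a *: (pi p : S) + pi q = pi ((a%:A)%:P * p + q).
  by rewrite polyquot_piD polyquot_piM.
by rewrite !scoef_pi // coefD coefCM mulr_algl.
Qed.

Lemma scoef0 j : j \in zindex t -> scoef j 0 = 0.
Proof.
move=> jt; have := scoef_lin 1 (0 : S) 0 jt.
by rewrite !scale1r addr0 => /esym/eqP; rewrite -subr_eq0 addrK => /eqP.
Qed.

Lemma scoefD j x y : j \in zindex t -> scoef j (x + y) = scoef j x + scoef j y.
Proof. by move=> jt; have := scoef_lin 1 x y jt; rewrite !scale1r. Qed.

Lemma scoef_sum j (I : Type) (s : seq I) (P : pred I) (F : I -> S) :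
  j \in zindex t ->
  scoef j (\sum_(i <- s | P i) F i) = \sum_(i <- s | P i) scoef j (F i).
Proof.
by move=> jt; apply: (big_morph (scoef j)) => [x y|]; [apply: scoefD | apply: scoef0].
Qed.

Lemma scoef_monom j i r : j \in zindex t ->
  scoef j (monom t r i) = if j == i then r else 0.
Proof.
move=> jt; rewrite scoef_pi // coefCM coefXn.
by case: eqP => _; rewrite ?mulr1 ?mulr0.
Qed.

Lemma scoef_sum_monom m (r : nat -> R) j : j \in zindex t ->
  scoef j (\sum_(i < m | (i : nat) \in zindex t) monom t (r i) i : S) =
  if (j < m)%N then r j else 0.
Proof.
move=> jt; rewrite scoef_sum //; under eq_bigr do rewrite scoef_monom //.
by rewrite (sum_ord_delta m (fun i => i \in zindex t)) jt andbT.
Qed.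

Lemma scoef_mulC j a x : j \in zindex t ->
  scoef j (monom t a 0 * x) = a * scoef j x.
Proof.
move=> jt; elim/polyquot_ind: x => p; rewrite -[_ * _]polyquot_piM.
by rewrite !scoef_pi // expr0 mulr1 coefCM.
Qed.

Lemma zindexS j : j.+1 \in zindex t -> j \in zindex t.
Proof. by rewrite !unfold_in; case: t => // n; apply: ltnW. Qed.

Lemma scoef_mulz j x : j \in zindex t ->
  scoef j (monom t 1 1 * x) = if j is i.+1 then scoef i x else 0.
Proof.
move=> jt; elim/polyquot_ind: x => p; rewrite -[_ * _]polyquot_piM.
rewrite !scoef_pi // mul1r coefXM.
by case: j jt => [|j] //= jt; rewrite scoef_pi //; apply: zindexS.
Qed.

Lemma scoef_ext x y : (forall j, j \in zindex t -> scoef j x = scoef j y) -> x = y.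
Proof.
move=> xy; rewrite -(polyquot_reprK x) -(polyquot_reprK y).
apply/polyquot_piP; set p := polyquot_repr x - _.
have p0 j : j \in zindex t -> p`_j = 0.
  by move=> jt; rewrite coefB; apply/eqP; rewrite subr_eq0; apply/eqP/xy.
move: p0; rewrite /zpow /zindex; case: t => [n|] p0; last first.
  by exists 0; rewrite mulr0; apply/polyP => i; rewrite p0 ?coef0 // unfold_in.
exists (drop_poly n p); rewrite -{1}(poly_take_drop n p).
suff -> : take_poly n p = 0 by rewrite add0r.
apply/polyP => i; rewrite coef_take_poly coef0; case: ifP => // ni.
by apply: p0; rewrite unfold_in.
Qed.

Lemma monom0 j : monom t (0 : R) j = 0.
Proof. by apply: scoef_ext => i it; rewrite scoef_monom // scoef0 // if_same. Qed.

Lemma monom_lin j (a : k) (r s : R) :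
  monom t (a *: r + s) j = a *: (monom t r j : S) + monom t s j.
Proof.
apply: scoef_ext => i it; rewrite scoef_lin // !scoef_monom //.
by case: eqP => // _; rewrite scaler0 addr0.
Qed.

Lemma monomM a r j : (monom t a 0 : S) * monom t r j = monom t (a * r) j.
Proof.
apply: scoef_ext => i it; rewrite scoef_mulC // !scoef_monom //.
by case: eqP => // _; rewrite mulr0.
Qed.

Lemma monomz r j : (monom t 1 1 : S) * monom t r j = monom t r j.+1.
Proof.
apply: scoef_ext => -[|i] it; rewrite scoef_mulz // !scoef_monom //.
exact: zindexS.
Qed.

(** As a ring, R[z]/(z^t) is generated by R and [z]. *)
Lemma z_closed_ideal (J : set S) : submod J ->
  (forall a x, J x -> J (monom t a 0 * x)) ->
  (forall x, J x -> J (monom t 1 1 * x)) -> ideal J.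
Proof.
move=> sJ JC Jz; split; [exact: sJ.1 | by move=> x y; apply: submodD |].
move=> s; elim/polyquot_ind: s => p; elim/poly_ind: p => [|p c IHp] x Jx.
  have -> : (pi 0 : S) = 0 by apply: scoef_ext => j jt; rewrite scoef_pi // coef0 scoef0.
  by rewrite mul0r; apply: sJ.1.
have -> : (pi (p * 'X + c%:P) : S) = pi p * monom t 1 1 + monom t c 0.
  rewrite polyquot_piD polyquot_piM; congr (_ * polyquot_pi _ _ + polyquot_pi _ _).
    by rewrite mul1r.
  by rewrite mulr1.
by rewrite mulrDl -mulrA; apply: submodD => //; [apply/IHp/Jz | apply: JC].
Qed.

(** The sum of the [W j z^j] for [j < min(m, t)]. *)
Definition box m W : set S :=
  [set x | forall j, j \in zindex t ->
     if (j < m)%N then W j (scoef j x) else scoef j x = 0].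

Lemma box_submod m W :
  (forall j, j \in zindex t -> (j < m)%N -> submod (W j)) -> submod (box m W).
Proof.
move=> sW; split=> [j jt|a x y bx by_ j jt].
  by rewrite scoef0 //; case: ifP => // jm; apply: (sW j jt jm).1.
rewrite scoef_lin //; have := bx j jt; have := by_ j jt.
case: ifP => jm; first by move=> ? ?; apply: (sW j jt jm).2.
by move=> -> ->; rewrite scaler0 addr0.
Qed.

Lemma box_has_dim m W (n : nat -> nat) :
  (forall j, j \in zindex t -> (j < m)%N -> submod (W j) /\ has_dim (W j) (n j)) ->
  has_dim (box m W) (\sum_(j < m | (j : nat) \in zindex t) n j).
Proof.
elim: m => [_|m IHm Wn].
  rewrite big_ord0; have -> : box 0 W = [set 0]; last exact: has_dim_set0.
  apply/seteqP; split=> [x bx|_ -> j jt]; last by rewrite scoef0.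
  by apply: scoef_ext => j jt; rewrite bx // scoef0.
have Wn' j : j \in zindex t -> (j < m)%N -> submod (W j) /\ has_dim (W j) (n j).
  by move=> jt jm; apply: Wn => //; apply: ltnW.
have {IHm}bm := IHm Wn'.
have [mt|mt] := boolP (m \in zindex t); last first.
  rewrite big_mkcond big_ord_recr /= (negPf mt) addn0 -big_mkcond.
  have -> // : box m.+1 W = box m W.
  have ltm j : j \in zindex t -> (j < m.+1)%N = (j < m)%N.
    move=> jt; rewrite (ltnS j m) (leq_eqVlt j m); case: eqP => // jm.
    by rewrite -jm jt in mt.
  by apply/seteqP; split=> x bx j jt; have := bx j jt; rewrite ltm.
rewrite big_mkcond big_ord_recr /= mt -big_mkcond.
have [sWm Wmn] := Wn m mt (ltnSn m).
pose f (r : R) : S := monom t r m.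
have fE r : scoef m (f r) = r by rewrite scoef_monom // eqxx.
have fW : has_dim (f @` W m) (n m).
  apply: has_dim_image => // [a x y|x fx]; first exact: monom_lin.
  by rewrite -(fE x) fx scoef0.
have -> : box m.+1 W = [set x + y | x in box m W & y in f @` W m].
  apply/seteqP; split=> [x bx|_ [x bx [_ [r Wr <-] <-]] j jt]; last first.
    rewrite scoefD // scoef_monom //; have := bx j jt.
    rewrite (ltnS j m) (leq_eqVlt j m); case: eqP => [->|_]; last by rewrite addr0.
    by rewrite ltnn => ->; rewrite add0r.
  exists (x - f (scoef m x)); last first.
    exists (f (scoef m x)); last by rewrite subrK.
    by exists (scoef m x) => //; have := bx m mt; rewrite ltnSn.
  move=> j jt; rewrite addrC -scaleN1r scoef_lin // scoef_monom //.
  have := bx j jt; rewrite (ltnS j m) (leq_eqVlt j m); case: eqP => [->|_ /=].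
    by rewrite ltnn scaleN1r addNr.
  by rewrite scaler0 add0r.
apply: has_dim_add => //.
- move=> x _ bx [r Wr <-] xr.
  have r0 : r = 0.
    have := bx m mt; rewrite ltnn => xm.
    by have := congr1 (scoef m) xr; rewrite scoefD // xm add0r fE scoef0.
  by move: xr; rewrite r0 /f monom0 addr0.
- by apply: box_submod => j jt jm; case: (Wn' j jt jm).
- split; first by exists 0; [apply: sWm.1 | apply: monom0].
  move=> a _ _ [r Wr <-] [s Ws <-]; exists (a *: r + s); first exact: sWm.2.
  exact: monom_lin.
Qed.

(** The least degree in R of a coefficient of an element of total degree [d]. The
    window [[low d, d.+1)] is empty when [t = 0]. *)
Definition low d := if t is Some n then (d.+1 - n)%N else 0%N.

Lemma low_step d : (low d <= low d.+1)%N /\ (low d.+1 <= (low d).+1)%N.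
Proof. by rewrite /low; case: t => [n|] //; split; lia. Qed.

Lemma zindex_low e j : (j \in zindex t) = (low (e + j) <= e)%N.
Proof. by rewrite unfold_in /low; case: t => [n|] //; lia. Qed.

Lemma zindex_low_sub d e : (e <= d)%N ->
  ((d - e)%N \in zindex t) = (low d <= e)%N.
Proof. by move=> ed; rewrite (zindex_low e) subnKC. Qed.

Lemma sum_zindex d (n : nat -> nat) :
  \sum_(j < d.+1 | (j : nat) \in zindex t) n (d - j)%N = psize (low d) d.+1 n.
Proof.
rewrite (reindex_inj rev_ord_inj) /=.
rewrite (eq_big (fun i : 'I_d.+1 => (low d <= i)%N) (fun i : 'I_d.+1 => n i)).
- by rewrite /psize (big_nat_widenl _ 0%N) // big_mkord.
- by move=> i; rewrite subSS zindex_low_sub // -ltnS.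
- by move=> i _; rewrite subSS subKn // -ltnS.
Qed.

End Coefficients.

Arguments box {k R} t m W.

(** * Bihomogeneous components of ideals *)

Section TotalGrading.
Variables (k : fieldType) (R : comAlgType k) (gr : nat -> set R) (t : option nat).
Hypothesis sg : standard_graded gr.
Local Notation S := (trunc_poly R t).
Local Notation low := (low t).

Lemma grzE (d j : nat) :
  grz gr (d%:Z - j%:Z) = if (j < d.+1)%N then gr (d - j)%N else [set 0].
Proof.
rewrite ltnS; case: leqP => jd; first by rewrite subzn.
have -> : d%:Z - j%:Z = Negz (j - d).-1 by rewrite NegzE; lia.
by [].
Qed.

Lemma total_grE d : total_gr gr t d = box t d.+1 (fun j => gr (d - j)%N).
Proof.
apply/seteqP; split=> [_ [r [gr_r ->]] j jt|x bx].
  rewrite scoef_sum_monom //; have := gr_r j; rewrite grzE.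
  by case: ltnP.
exists (fun j => if j \in zindex t then scoef j x else 0); split=> [j|].
  rewrite grzE; have [jt|_] := boolP (j \in zindex t).
    by have := bx j jt; case: ifP.
  by case: ifP => // _; apply: gr0 sg _.
apply: scoef_ext => j jt.
rewrite (scoef_sum_monom _ (fun j => if j \in zindex t then scoef j x else 0)) // jt.
by have := bx j jt; case: ifP.
Qed.

Section ZStable.
Variables (L : nat -> nat -> set R) (r : nat -> nat -> nat).
Hypothesis gs : growth_system gr L r.
Local Notation h e := (dimk (gr e)).
Variable I : set S.
Hypothesis zI : z_stable_ideal gr I.

Definition zcomp j e : set R := [set a | gr e a /\ I (monom t a j)].

Definition zdim d e := dimk (zcomp (d - e) e).

Lemma zI_scale (a : k) x : I x -> I (a *: x).
Proof. by have [[_ _ IM] _ _] := zI; apply: IM. Qed.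

Lemma zcomp_submod j e : submod (zcomp j e).
Proof.
have [[I0 ID _] _ _] := zI.
split; first by split; [apply: gr0 sg _ | rewrite monom0].
move=> a x y [gx Ix] [gy Iy]; split; first exact: (gr_submod sg e).2.
by rewrite monom_lin; apply: ID => //; apply: zI_scale.
Qed.

Lemma zcomp_gr j e : zcomp j e `<=` gr e.
Proof. by move=> x []. Qed.

Lemma zcomp_dim j e : has_dim (zcomp j e) (dimk (zcomp j e)).
Proof. exact: (sub_has_dim (zcomp_submod j e) (@zcomp_gr j e) (gr_has_dim sg e)).1. Qed.

Lemma zdim_le d e : (zdim d e <= h e)%N.
Proof. exact: (sub_has_dim (zcomp_submod _ e) (@zcomp_gr _ e) (gr_has_dim sg e)).2. Qed.

(** A multigraded ideal contains each bihomogeneous part of its elements: comparing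
    the component of bidegree [(d - j, j)] on both sides of a bihomogeneous
    expansion of [x] identifies [scoef j x] with the coefficient of one term. *)
Lemma zideal_box d : I `&` total_gr gr t d = box t d.+1 (fun j => zcomp j (d - j)).
Proof.
have [[I0 ID _] mI _] := zI.
rewrite total_grE; apply/seteqP; split=> [x [Ix bx] j jt|x bx].
  have := bx j jt; case: ltnP => // jd gj; split=> //.
  have [n [c [Ic xE]]] := mI x Ix.
  have sE : scoef j x = \sum_(i < n) \sum_(l < n | (l : nat) \in zindex t)
      if j == l then scoef j (c i l) else 0.
    rewrite {1}xE scoef_sum //; apply: eq_bigr => i _.
    rewrite scoef_sum //; apply: eq_bigr => l lt.
    by have [_ [s _ <-]] := Ic i l lt; rewrite scoef_monom //; case: eqP.
  have -> : scoef j x = if (j < n)%N && (d - j < n)%N then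
      scoef j (c (d - j)%N j) else 0.
    have -> : scoef j x = hcomp gr (d - j) (scoef j x) by rewrite (hcomp_id sg _ gj) eqxx.
    rewrite sE (hcomp_sum sg).
    transitivity (\sum_(i < n) if (d - j)%N == i then
        if (j < n)%N then scoef j (c i j) else 0 else 0); last first.
      rewrite (sum_ord_delta n xpredT
        (fun i => if (j < n)%N then scoef j (c i j) else 0)).
      by rewrite andbT andbC; case: ((d - j < n)%N).
    apply: eq_bigr => i _.
    rewrite (sum_ord_delta n (fun i => i \in zindex t)
      (fun l => scoef j (c i l))) /= jt andbT.
    case: ifP => _; last by rewrite (hcomp0 sg) if_same.
    apply: (hcomp_id sg); have [_ [s gs_ <-]] := Ic i j jt.
    by rewrite scoef_monom // eqxx.
  case: ifP => _; last by rewrite monom0.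
  by have [Icj [s _ sc]] := Ic (d - j)%N j jt; rewrite -sc scoef_monom // eqxx sc.
split; last by move=> j jt; have := bx j jt; case: ifP => // _ [].
have -> : x = \sum_(j < d.+1 | (j : nat) \in zindex t) monom t (scoef j x) j.
  apply: scoef_ext => j jt; rewrite (scoef_sum_monom _ (fun i => scoef i x)) //.
  by have := bx j jt; case: ifP.
elim/big_ind: _ => // i it; have := bx i it; rewrite ltn_ord => -[_] //.
Qed.

Lemma zideal_series d :
  hilbert_series (total_gr gr t) I d = (psize (low d) d.+1 (zdim d))%:Z.
Proof.
rewrite /hilbert_series zideal_box; congr Posz; apply: dimkE.
rewrite -sum_zindex.
rewrite (eq_bigr (fun j : 'I_d.+1 => dimk (zcomp j (d - j)))) => [|j _]; last first.
  by rewrite /zdim (subKn (ltn_ord j : j <= d)%N).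
apply: (box_has_dim (n := fun j => dimk (zcomp j (d - j)))) => j _ _.
by split; [apply: zcomp_submod | apply: zcomp_dim].
Qed.

(** z-stability says that R_1 carries the component of degree [e] into that of
    degree [e.+1]. *)
Lemma zdim_stable d : stable (fun e => h e) r (low d) d.+1 (zdim d).
Proof.
split=> [e _ _|e loe]; first exact: zdim_le.
rewrite ltnS => ed; apply: (gs_growth_min gs (U := zcomp (d - e) e)
  (W := zcomp (d - e.+1) e.+1)); try exact: zcomp_submod;
  try exact: zcomp_gr; try exact: zcomp_dim.
move=> x y gx [gy Iy]; split; first exact: (grM sg gx gy).
have [_ _ /(_ d (d - e)%N)] := zI; rewrite zindex_low_sub ?(ltnW ed) // subn_gt0.
move=> /(_ loe ed x y gx)[|_].
  split; first by rewrite grzE ltnS leq_subr subKn // ltnW.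
  split=> //; rewrite total_grE => j jt; rewrite scoef_monom //.
  case: eqP => [->|_]; first by rewrite ltnS leq_subr subKn // ltnW.
  by case: ifP => // _; apply: gr0 sg _.
by rewrite -subnS => -[].
Qed.

Lemma zdim_mulz d e : (e <= d)%N -> (zdim d e <= zdim d.+1 e)%N.
Proof.
move=> ed; apply: (sub_has_dim (zcomp_submod _ _) _ (zcomp_dim _ _)).2.
move=> x [gx Ix]; split=> //; rewrite subSn // -monomz.
by have [[_ _ IM] _ _] := zI; apply: IM.
Qed.

Lemma zdim_top d : (r d (zdim d d) <= zdim d.+1 d.+1)%N.
Proof.
apply: (gs_growth_min gs (U := zcomp (d - d) d) (W := zcomp (d.+1 - d.+1) d.+1));
  try exact: zcomp_submod; try exact: zcomp_gr; try exact: zcomp_dim.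
move=> x y gx [gy Iy]; split; first exact: (grM sg gx gy).
by rewrite !subnn in Iy *; rewrite -monomM; have [[_ _ IM] _ _] := zI; apply: IM.
Qed.

End ZStable.

(** * The ideal with prescribed profiles *)

Section ProfileIdeal.
Variables (L : nat -> nat -> set R) (r : nat -> nat -> nat).
Hypothesis gs : growth_system gr L r.
Local Notation h e := (dimk (gr e)).

(** The sum over all bidegrees [(e, j)] of [L e n z^j], where [n = A (e + j) e] is
    prescribed by the profile of the total degree [e + j]. *)
Definition profile_ideal (A : nat -> nat -> nat) : set S :=
  [set x | forall e j, j \in zindex t -> L e (A (e + j)%N e) (hcomp gr e (scoef j x))].

Lemma profile_ideal_homo A B :
  (forall d e, (low d <= e)%N -> (e <= d)%N -> (A d e <= B d e)%N) ->
  profile_ideal A `<=` profile_ideal B.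
Proof.
move=> AB x Jx e j jt; apply: gs_homo gs _ _ _ _ _ (Jx e j jt).
by apply: AB; rewrite -?zindex_low ?leq_addr.
Qed.

Variable A : nat -> nat -> nat.
Local Notation J := (profile_ideal A).

Lemma profile_submod : submod J.
Proof.
split=> [e j jt|a x y Jx Jy e j jt].
  by rewrite scoef0 // (hcomp0 sg); apply: (gs_submod gs _ _).1.
rewrite scoef_lin // (hcomp_lin sg).
by apply: (gs_submod gs _ _).2; [apply: Jx | apply: Jy].
Qed.

Lemma profile_box d :
  J `&` total_gr gr t d = box t d.+1 (fun j => L (d - j) (A d (d - j))).
Proof.
rewrite total_grE; apply/seteqP; split=> [x [Jx bx] j jt|x bx].
  have := bx j jt; case: ltnP => // jd gx; have := Jx (d - j)%N j jt.
  by rewrite (hcomp_id sg _ gx) eqxx subnK.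
split=> [e j jt|j jt]; last by have := bx j jt; case: ifP => // _; apply: gs_gr gs _ _ _.
have := bx j jt; case: ltnP => [jd Lx|_ ->]; last first.
  by rewrite (hcomp0 sg); apply: (gs_submod gs _ _).1.
rewrite (hcomp_id sg _ (gs_gr gs Lx)); case: eqP => [->|_]; last first.
  exact: (gs_submod gs _ _).1.
by rewrite subnK.
Qed.

Lemma profile_series d :
  (forall e, (low d <= e)%N -> (e <= d)%N -> (A d e <= h e)%N) ->
  hilbert_series (total_gr gr t) J d = (psize (low d) d.+1 (A d))%:Z.
Proof.
move=> Ah; rewrite /hilbert_series profile_box; congr Posz; apply: dimkE.
rewrite -sum_zindex; apply: (box_has_dim (n := fun j => A d (d - j)%N)) => j jt jd.
split; first exact: (gs_submod gs).
apply: (gs_dim gs); apply: Ah; last exact: leq_subr.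
by rewrite -zindex_low_sub ?leq_subr // subKn.
Qed.

(** The two hypotheses on [A] express stability under [z] and under R_1. *)
Lemma profile_homogeneous :
  (forall d e, (low d.+1 <= e)%N -> (e <= d)%N -> (A d e <= A d.+1 e)%N) ->
  (forall d e, (low d <= e)%N -> (e <= d)%N -> (r e (A d e) <= A d.+1 e.+1)%N) ->
  homogeneous_ideal (total_gr gr t) J.
Proof.
move=> Az A1; have sJ := profile_submod.
split.
  apply: z_closed_ideal => // [|x Jx e [|j] jt].
  - apply: (@gr1_closed _ _ _ sg S (fun a x => monom t a 0 * x) J) => //.
    + by move=> x; apply: scoef_ext => j jt; rewrite scoef_mulC // mul1r.
    + by move=> a b x; rewrite mulrA monomM.
    + move=> c a b x; apply: scoef_ext => j jt.
      by rewrite scoef_lin // !scoef_mulC // mulrDl scalerAl.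
    + move=> a x ga Jx [|e] j jt; rewrite scoef_mulC //.
        by rewrite (hcomp_mul1 sg _ ga).1; apply: (gs_submod gs _ _).1.
      rewrite (hcomp_mul1 sg _ ga).2; apply: (gs_mul gs) (Jx e j jt) => //.
      by rewrite addSn; apply: A1; rewrite -?zindex_low ?leq_addr.
  - by rewrite scoef_mulz // (hcomp0 sg); apply: (gs_submod gs _ _).1.
  - rewrite scoef_mulz //; apply: gs_homo gs _ _ _ _ _ (Jx e j (zindexS jt)).
    by rewrite addnS; apply: Az; rewrite -?addnS -?zindex_low ?leq_addr.
move=> x Jx.
pose part d : S := \sum_(j < d.+1 | (j : nat) \in zindex t)
  monom t (hcomp gr (d - j) (scoef j x)) j.
have partE d j : j \in zindex t -> scoef j (part d) =
    if (j < d.+1)%N then hcomp gr (d - j) (scoef j x) else 0.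
  exact: (scoef_sum_monom _ (fun j => hcomp gr (d - j) (scoef j x))).
(* [N j] bounds the degree in R of the coefficient of [z^j], and [m] the exponent
   of [z]. *)
have /choice[N NE] := fun j => hcomp_sumE sg (scoef j x).
pose m := size (polyquot_repr x).
pose M := (m + \max_(j < m) N j)%N.
exists M, part; split=> [d|].
  rewrite profile_box => j jt; rewrite partE //; case: ltnP => // jd.
  by have := Jx (d - j)%N j jt; rewrite subnK.
apply: scoef_ext => j jt; rewrite scoef_sum //.
under eq_bigr => d _ do rewrite partE //.
have [jm|mj] := ltnP j m; last first.
  have xj : scoef j x = 0 by rewrite /scoef nth_default.
  by rewrite xj big1 // => d _; rewrite (hcomp0 sg) if_same.
have NM : (N j <= M - j)%N.
  have := leq_bigmax (F := fun i : 'I_m => N i) (Ordinal jm).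
  by rewrite /M /=; lia.
have jM : (j <= M)%N by rewrite /M; lia.
rewrite {1}(NE j _ NM) -(big_mkord xpredT (fun d =>
  if (j < d.+1)%N then hcomp gr (d - j)%N (scoef j x) else 0)).
rewrite (big_cat_nat (leq0n j) jM) /= big_nat_cond.
rewrite [X in _ = X + _]big1 ?add0r; last first.
  by move=> i /andP[ij _]; rewrite ifN //; lia.
rewrite -[X in \sum_(X <= _ < _) _]add0n big_addn big_mkord; apply: eq_bigr => i _.
by rewrite ifT ?addnK //; lia.
Qed.

End ProfileIdeal.

End TotalGrading.

(** * Lifting the embedding *)

Theorem theorem3p3 (k : fieldType) (R : comAlgType k) (gr : nat -> set R)
    (t : option nat) :
  standard_graded gr ->
  admits_embedding gr (homogeneous_ideal gr) ->
  (forall H : nat -> int,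
     hilbert_set (total_gr gr t) (homogeneous_ideal (total_gr gr t)) H ->
     exists I : set (trunc_poly R t),
       z_stable_ideal gr I /\ hilbert_series (total_gr gr t) I = H) ->
  admits_embedding (total_gr gr t) (homogeneous_ideal (total_gr gr t)).
Proof.
move=> sg [eps [eps_ideal epsK _ eps_homo]] zstab.
have [L [r gs]] : exists L r, growth_system gr L r.
  have gs := eps_growth_system sg eps_ideal epsK eps_homo.
  by do 2 eexists; apply: gs.
pose h e := dimk (gr e).
have r_homo := gs_growth_homo gs; have r0 := gs_growth0 gs.
have r_le : forall e, (r e (h e) <= h e.+1)%N := gs_growth_le gs.
(* The segment of size [n] in degree [d]; it depends on nothing else, which is
   what makes the embedding monotone. *)
pose seg d n : nat -> nat := xget (fun=> 0%N)
  [set a | segment h r (low t d) d.+1 a /\ psize (low t d) d.+1 a = n].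
pose A (H : nat -> int) d := seg d `|H d|%N.
have segP d n : (n <= psize (low t d) d.+1 h)%N ->
    segment h r (low t d) d.+1 (seg d n) /\ psize (low t d) d.+1 (seg d n) = n.
  move=> n_le; have [a sg_a sa] := segment_exists r_homo r0 r_le n_le.
  by rewrite /seg; case: xgetP => [_ -> //|/(_ a)]; case.
pose HS := hilbert_set (total_gr gr t) (homogeneous_ideal (total_gr gr t)).
(* [b d] is the profile in degree [d] of a z-stable ideal with series [H]. *)
have zH H : HS H -> exists b : nat -> nat -> nat,
    [/\ forall d, stable h r (low t d) d.+1 (b d),
        forall d, H d = (psize (low t d) d.+1 (b d))%:Z,
        forall d e, (e <= d)%N -> (b d e <= b d.+1 e)%N
      & forall d, (r d (b d d) <= b d.+1 d.+1)%N].
  move=> /zstab[I [zI <-]]; exists (zdim gr I); split.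
  - by move=> d; apply: (zdim_stable sg gs zI).
  - by move=> d; apply: (zideal_series sg zI).
  - by move=> d e; apply: (zdim_mulz sg zI).
  - by move=> d; apply: (zdim_top sg gs zI).
have AP H d : HS H -> segment h r (low t d) d.+1 (A H d) /\
    (psize (low t d) d.+1 (A H d))%:Z = H d.
  move=> /zH[b [st_b Hb _ _]].
  have n_le : (`|H d| <= psize (low t d) d.+1 h)%N.
    by rewrite Hb; apply: psize_le => e loe ed; apply: (st_b d).1.
  have [sg_A sA] := segP d _ n_le; split; first exact: sg_A.
  by rewrite /A sA Hb.
have series H : HS H -> hilbert_series (total_gr gr t) (profile_ideal gr L (A H)) = H.
  move=> HH; apply/funext => d; rewrite (profile_series sg gs).
    exact: (AP H d HH).2.
  by move=> e loe ed; apply: (AP H d HH).1.1.1.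
exists (fun H => profile_ideal gr L (A H)); split=> //.
- move=> H HH; have [b [st_b Hb bz b1]] := zH H HH.
  have size_Ab d : psize (low t d) d.+1 (A H d) = psize (low t d) d.+1 (b d).
    by apply/eqP; rewrite -eqz_nat (AP H d HH).2 Hb.
  have growth d : (low t d <= d)%N ->
      (forall e, (low t d.+1 <= e)%N -> (e <= d)%N -> (A H d e <= A H d.+1 e)%N) /\
      (r d (A H d d) <= A H d.+1 d.+1)%N.
    move=> ld; apply: (segment_growth r_homo r0 r_le ld (b := b d) (b' := b d.+1)) => //.
    + exact: (low_step t d).1.
    + exact: (low_step t d).2.
    + exact: (AP H d HH).1.
    + exact: (AP H d.+1 HH).1.
    + by move=> e _; apply: bz.
  apply: (profile_homogeneous sg gs) => d e loe ed.
    apply: (growth d _).1 => //; apply: leq_trans ed; apply: leq_trans loe.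
    exact: (low_step t d).1.
  have ld : (low t d <= d)%N by apply: leq_trans ed.
  move: ed; rewrite leq_eqVlt => /predU1P[->|ed]; first exact: (growth d ld).2.
  apply: leq_trans ((AP H d HH).1.1.2 e loe ed) _.
  by apply: (growth d ld).1 => //; have := (low_step t d).2; lia.
- by move=> H H' HH HH' eqJ; rewrite -(series H HH) eqJ series.
- move=> H H' HH HH' le_H; apply: (profile_ideal_homo gs) => d e loe ed.
  apply: (segment_le (AP H d HH).1 (AP H' d HH').1) => //.
  by rewrite -lez_nat (AP H d HH).2 (AP H' d HH').2; apply: le_H.
Qed.
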